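(* Let $A\in L(\ell^2(\mathcal H))$ be self-adjoint and positive definite. Let $n\in\mathbb N_0$, $m\in\mathbb N$, $f^{(n)}\in\ell_A^2(\mathcal H)^{\widehat\otimes n}$ and let $\{\psi_1,\dots,\psi_m\}$ be an orthonormal system in $\ell_A^2(\mathcal H)$. Then for $\mathcal G:=\sigma\big(\langle\psi_k,\cdot\rangle,\ k=1,\dots,m\big)$ we have $$\mathbb E\Big[\big\langle f^{(n)},\colon\cdot^{\otimes n}\colon\big\rangle\Big|\mathcal G\Big]=\big\langle \mathcal P_\psi^{\otimes n}f^{(n)},\colon\cdot^{\otimes n}\colon\big\rangle ,$$ where $\mathcal P_\psi:\ell_A^2(\mathcal H)\to\mathrm{span}\{\psi_1,\dots,\psi_m\}$ is the orthogonal projection, i.e. $\mathcal P_\psi f=\sum_{k=1}^m(f,\psi_k)_A\psi_k$ for $f\in\ell_A^2(\mathcal H)$.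
   Context: Setting. $\mathcal H$ is a real separable infinite-dimensional Hilbert space and $\mathcal N\subset\mathcal H\subset\mathcal N'$ a Gel'fand triple, i.e. $\mathcal N$ is a real topological vector space whose topology is given by increasing, compatible Hilbert norms $\|\cdot\|_p$, $p\in\mathbb N_0$ (compatible: a sequence $\|\cdot\|_p$-converging to $0$ and $\|\cdot\|_q$-Cauchy also $\|\cdot\|_q$-converges to $0$), $\mathcal N$ is complete as a metrizable space, its completions $\mathcal N_p$ with respect to $\|\cdot\|_p$ satisfy $\mathcal N_0=\mathcal H$, and the inclusions $\mathcal N_{p+1}\hookrightarrow\mathcal N_p$ are Hilbert–Schmidt. $\ell^2(\mathcal H)$ is the Hilbert space of square summable sequences in $\mathcal H$; $\ell^2_p(\mathcal N_p)=\{f\in\mathcal N_p^{\mathbb N}:\sum_k k^{2p}\|f_k\|_p^2<\infty\}$; $s(\mathcal N):=\bigcap_{p\in\mathbb N_0}\ell_p^2(\mathcal N_p)$ with the topology given by these norms; $s'(\mathcal N)$ is its topological dual with dual pairing $\langle\phi,\omega\rangle=\omega(\phi)$, equipped with the $\sigma$-algebra generated by the maps $\omega\mapsto\langle\phi,\omega\rangle$, $\phi\in s(\mathcal N)$. For self-adjoint positive definite $A\in L(\ell^2(\mathcal H))$ (i.e. $(f,Af)>0$ for $f\neq0$), $(f,g)_A:=(f,Ag)_{\ell^2(\mathcal H)}$, $\|f\|_A:=\sqrt{(f,f)_A}$, and $\mu_A$ is the unique probability measure on $s'(\mathcal N)$ with $\int\exp(i\langle\phi,\omega\rangle)\,d\mu_A(\omega)=\exp(-\tfrac12(\phi,\phi)_A)$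 for all $\phi\in s(\mathcal N)$ (Bochner–Minlos). $L^2(\mu_A)$ is the real space $L^2(s'(\mathcal N),\mu_A;\mathbb R)$. $\ell_A^2(\mathcal H)$ is the completion of $\ell^2(\mathcal H)$ with respect to $(\cdot,\cdot)_A$; $s(\mathcal N)$ is dense in it. For $f\in\ell_A^2(\mathcal H)$, $\langle f,\cdot\rangle\in L^2(\mu_A)$ is the $L^2(\mu_A)$-limit of $\langle\phi_k,\cdot\rangle$ for any $\phi_k\in s(\mathcal N)$ with $\phi_k\to f$ in $\ell_A^2(\mathcal H)$. Tensor powers. $s(\mathcal N)^{\otimes n}$ is the algebraic tensor power, $s(\mathcal N)^{\widehat\otimes n}$ its subspace of symmetric tensors. $\ell_A^2(\mathcal H)^{\otimes n}$ is the Hilbert space tensor power (completion with respect to $(f_1\otimes\cdots\otimes f_n,g_1\otimes\cdots\otimes g_n)_A=\prod_k(f_k,g_k)_A$), and $\ell_A^2(\mathcal H)^{\widehat\otimes n}$ is the closure in it of the span of $\{f^{\otimes n}\}$; the $0$-th powers are $\mathbb R$. For a bounded operator $L$ on $\ell_A^2(\mathcal H)$, $L^{\otimes n}$ is the bounded extension to $\ell_A^2(\mathcal H)^{\otimes n}$ of $f_1\otimes\cdots\otimes f_n\mapsto Lf_1\otimes\cdots\otimes Lf_n$, and $L^{\otimes0}=\mathrm{id}_{\mathbb R}$. Wick powers. $\tau_A:s(\mathcal N)^{\otimes2}\to\mathbb R$ is the linear map with $\tau_A(\phi\otimes\psi)=(\phi,\psi)_A$. For $\omega\in s'(\mathcal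 N)$ define linear functionals $\colon\omega^{\otimes n}\colon$ on $s(\mathcal N)^{\otimes n}$ by $\colon\omega^{\otimes0}\colon=\mathrm{id}_{\mathbb R}$, $\colon\omega^{\otimes1}\colon=\omega$, $\colon\omega^{\otimes n}\colon=\omega\widehat\otimes\colon\omega^{\otimes n-1}\colon-(n-1)\tau_A\widehat\otimes\colon\omega^{\otimes n-2}\colon$ for $n\ge2$, where $F\widehat\otimes G$ is the tensor product functional $F\otimes G$ composed with symmetrization of tensors. For $f^{(n)}\in\ell_A^2(\mathcal H)^{\widehat\otimes n}$, $\langle f^{(n)},\colon\cdot^{\otimes n}\colon\rangle\in L^2(\mu_A)$ is the $L^2(\mu_A)$-limit of $\omega\mapsto\langle\phi_k^{(n)},\colon\omega^{\otimes n}\colon\rangle$ for any sequence $\phi_k^{(n)}\in s(\mathcal N)^{\widehat\otimes n}$ converging to $f^{(n)}$ in $\ell_A^2(\mathcal H)^{\otimes n}$ (the limit exists and does not depend on the sequence). Conditional expectations of elements of $L^2(\mu_A)$ are regarded as elements of $L^2(\mu_A)$ (equality is $\mu_A$-a.s.). The $\sigma$-algebra generated by equivalence classes of random variables is formed from arbitrary representatives; the conditional expectation, as an element of $L^2(\mu_A)$, does not depend on this choice. *)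

(* Defs.v *)
From HB Require Import structures.
From mathcomp Require Import all_boot all_order perm all_algebra.
From mathcomp Require Import all_classical all_reals all_analysis.
From mathcomp Require Import ring.

Set Implicit Arguments.
Unset Strict Implicit.
Unset Printing Implicit Defensive.

Import Order.TTheory GRing.Theory Num.Theory.
Import numFieldNormedType.Exports.

Local Open Scope classical_set_scope.
Local Open Scope ring_scope.

HB.mixin Record CompleteNormedModule_isHilbert (R : realType) V
    & CompleteNormedModule R V := {
  inner : {dot V for @idfun R} ;
  inner_norm : forall x : V, inner x x = `|x| ^+ 2
}.

#[short(type="hilbertType")]
HB.structure Definition Hilbert (R : realType) :=
  {V of CompleteNormedModule R V & CompleteNormedModule_isHilbert R V}.

Section linear_spaces.
Context {R : realType}.

Definition lspan (V : lmodType R) (S : set V) : set V :=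
  [set x | exists n (c : 'I_n -> R) (v : 'I_n -> V),
     (forall i, S (v i)) /\ x = \sum_(i < n) c i *: v i].

Definition separable_space (V : hilbertType R) :=
  exists2 D : set V, countable D & dense D.

Definition infinite_dimensional (V : lmodType R) :=
  forall n (v : 'I_n -> V), lspan (range v) <> setT.

Definition orthonormal_family (V : hilbertType R) (I : eqType) (e : I -> V) :=
  forall i j, inner (e i) (e j) = (i == j)%:R.

Definition orthonormal_basis (V : hilbertType R) (e : nat -> V) :=
  orthonormal_family e /\ dense (lspan (range e)).

Definition hilbert_schmidt (V W : hilbertType R) (L : V -> W) :=
  exists2 e : nat -> V, orthonormal_basis e
    & cvgn (series (fun k => `|L (e k)| ^+ 2)).

(* The completion is only determined up to isometry, hence a predicate. *)
Definition is_completion (V : lmodType R) (ip : V -> V -> R)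
    (W : hilbertType R) (j : V -> W) :=
  [/\ linear j, forall x y, inner (j x) (j y) = ip x y & dense (range j)].

End linear_spaces.

Section gelfand.
Context {R : realType}.

Section norms.
Context {V : lmodType R}.
Implicit Types (ip : V -> V -> R) (u : nat -> V).

Definition ipnorm ip x : R := Num.sqrt (ip x x).

Definition ipcvg ip u x := ipnorm ip (u k - x) @[k --> \oo] --> (0 : R).

Definition ipcauchy ip u := forall e : R, 0 < e ->
  exists K, forall i j, (K <= i)%N -> (K <= j)%N -> ipnorm ip (u i - u j) < e.

End norms.

(* [gN] is the space N with the inner products [gip p] of its Hilbert norms;
   [gNp p] is its completion N_p and [gincl p] the inclusion of N_(p+1) in N_p,
   i.e. the continuous extension of the identity of N.  The central space H of
   the triple is [gNp 0], written [gH]. *)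
Record gelfand_triple := GelfandTriple {
  gN : lmodType R ;
  gip : nat -> {dot gN for @idfun R} ;
  gip_increasing : forall p x, ipnorm (gip p) x <= ipnorm (gip p.+1) x ;
  gip_compatible : forall p q (u : nat -> gN),
    ipcvg (gip p) u 0 -> ipcauchy (gip q) u -> ipcvg (gip q) u 0 ;
  gN_complete : forall u : nat -> gN, (forall p, ipcauchy (gip p) u) ->
    exists x, forall p, ipcvg (gip p) u x ;
  gNp : nat -> hilbertType R ;
  gemb : forall p, gN -> gNp p ;
  gemb_completion : forall p, is_completion (gip p) (gemb p) ;
  gincl : forall p, {linear gNp p.+1 -> gNp p} ;
  gincl_continuous : forall p, continuous (gincl p) ;
  gincl_emb : forall p x, gincl p (gemb p.+1 x) = gemb p x ;
  gincl_HS : forall p, hilbert_schmidt (gincl p)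
}.

End gelfand.
Arguments gelfand_triple : clear implicits.
Notation gH G := (gNp G 0).

Section weighted_sums.
Context {R : realType} {V : hilbertType R}.

Lemma weighted_sum_closed (w : nat -> R) (a : R) (f g : nat -> V) :
  (forall k, 0 <= w k) ->
  cvgn (series (fun k => w k * `|f k| ^+ 2)) ->
  cvgn (series (fun k => w k * `|g k| ^+ 2)) ->
  cvgn (series (fun k => w k * `|a *: f k + g k| ^+ 2)).
Proof.
move=> w0 cf cg.
apply: (@series_le_cvg _ _
  (fun k => (2 * a ^+ 2) * (w k * `|f k| ^+ 2) + 2 * (w k * `|g k| ^+ 2))).
- by move=> k; rewrite mulr_ge0 ?w0 ?sqr_ge0.
- move=> k; have sq (x : R) : 0 <= x ^+ 2 := sqr_ge0 x.
  exact: (addr_ge0 (mulr_ge0 (mulr_ge0 (ler0n _ 2) (sq a))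
    (mulr_ge0 (w0 k) (sq _))) (mulr_ge0 (ler0n _ 2) (mulr_ge0 (w0 k) (sq _)))).
- move=> k /=.
  have h : `|a *: f k + g k| ^+ 2 <= 2 * a ^+ 2 * `|f k| ^+ 2 + 2 * `|g k| ^+ 2.
    apply: (@le_trans _ _ ((`|a| * `|f k| + `|g k|) ^+ 2)).
      by rewrite lerXn2r ?nnegrE ?addr_ge0 ?mulr_ge0// -normrZ ler_normD.
    rewrite -(real_normK (num_real a)) -subr_ge0.
    set x := `|a|; set y := `|f k|; set z := `|g k|.
    have -> : 2 * x ^+ 2 * y ^+ 2 + 2 * z ^+ 2 - (x * y + z) ^+ 2
      = (x * y - z) ^+ 2 by ring.
    exact: sqr_ge0.
  by apply: le_trans (ler_wpM2l (w0 k) h) _; rewrite le_eqVlt; apply/orP; left;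
    apply/eqP; ring.
- rewrite (_ : (fun k => _) = (2 * a ^+ 2) *: (fun k => w k * `|f k| ^+ 2)
    + 2 *: (fun k => w k * `|g k| ^+ 2)); last exact/funext.
  by apply: is_cvg_seriesD; apply: is_cvg_seriesZ.
Qed.

End weighted_sums.

Section l2.
Context {R : realType} (V : hilbertType R).

Definition l2_set : set (nat -> V) :=
  [set f | cvgn (series (fun k => `|f k| ^+ 2 : R))].

Definition l2_pred : {pred (nat -> V)} := mem l2_set.

Record l2 := L2 { l2_val :> nat -> V ; _ : l2_val \in l2_pred }.

HB.instance Definition _ := [isSub for l2_val].
HB.instance Definition _ := [Choice of l2 by <:].

Lemma l2_submod_closed : submod_closed l2_pred.
Proof.
split=> [|a f g /set_mem/= fl /set_mem/= gl]; apply/mem_set => /=.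
  rewrite /l2_set /= (_ : series _ = cst (0 : R)); first exact: is_cvg_cst.
  by apply/funext => n; rewrite /series /= big1// => k _; rewrite normr0 expr0n.
have := @weighted_sum_closed _ _ (fun=> 1) a f g (fun=> ler01).
rewrite (_ : (fun k => 1 * `|f k| ^+ 2) = fun k => `|f k| ^+ 2); last first.
  by apply/funext => k; rewrite mul1r.
rewrite (_ : (fun k => 1 * `|g k| ^+ 2) = fun k => `|g k| ^+ 2); last first.
  by apply/funext => k; rewrite mul1r.
move=> /(_ fl gl); rewrite /l2_set /=.
by under eq_fun do rewrite mul1r.
Qed.

HB.instance Definition _ :=
  GRing.isSubmodClosed.Build R (nat -> V) l2_pred l2_submod_closed.
HB.instance Definition _ := [SubChoice_isSubLmodule of l2 by <:].

Definition l2_inner (f g : l2) : R := limn (series (fun k => inner (f k) (g k))).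

End l2.

Section sN.
Context {R : realType} (G : gelfand_triple R).

(* Sequences are indexed from 0, so the weight k^(2p) of the k-th term, k >= 1,
   becomes (k + 1)^(2p). *)
Definition l2p_terms p (g : nat -> gNp G p) (k : nat) : R :=
  k.+1%:R ^+ (2 * p) * `|g k| ^+ 2.

Definition l2p_set p : set (nat -> gNp G p) :=
  [set g | cvgn (series (l2p_terms g))].

Definition l2p_norm p (g : nat -> gNp G p) : R :=
  Num.sqrt (limn (series (l2p_terms g))).

Fixpoint gNp_to_H p : gNp G p -> gH G :=
  if p is q.+1 then fun x => gNp_to_H (gincl G q x) else id.

Lemma gNp_to_H_linear p : linear (@gNp_to_H p).
Proof. by elim: p => [|p IHp] a x y //=; rewrite linearP IHp. Qed.

Lemma gNp_to_H0 p : gNp_to_H (0 : gNp G p) = 0.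
Proof. by elim: p => [|p IHp] //=; rewrite linear0. Qed.

(* The intersection of the l^2_p(N_p), taken inside the sequences in H. *)
Definition sN_set : set (nat -> gH G) :=
  \bigcap_p ((fun g k => gNp_to_H (g k)) @` @l2p_set p).

Definition sN_pred : {pred (nat -> gH G)} := mem sN_set.

Record sN := SN { sN_val :> nat -> gH G ; _ : sN_val \in sN_pred }.

HB.instance Definition _ := [isSub for sN_val].
HB.instance Definition _ := [Choice of sN by <:].

Lemma sN_submod_closed : submod_closed sN_pred.
Proof.
split=> [|a f g /set_mem fs /set_mem gs]; apply/mem_set => p _.
  exists (fun=> 0).
    rewrite /l2p_set /= (_ : series _ = cst (0 : R)); first exact: is_cvg_cst.
    apply/funext => n; rewrite /series /= big1// => k _.
    by rewrite /l2p_terms normr0 expr0n mulr0.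
  by apply/funext => k; exact: gNp_to_H0.
have [f' f'l f'E] := fs p I; have [g' g'l g'E] := gs p I.
exists (fun k => a *: f' k + g' k).
  by apply: weighted_sum_closed f'l g'l => k; rewrite exprn_ge0 ?ler0n.
by apply/funext => k; rewrite gNp_to_H_linear -f'E -g'E.
Qed.

HB.instance Definition _ :=
  GRing.isSubmodClosed.Build R (nat -> gH G) sN_pred sN_submod_closed.
HB.instance Definition _ := [SubChoice_isSubLmodule of sN by <:].

Lemma sN_valP (f : sN) : sN_set f.
Proof. exact: set_mem (valP f). Qed.

(* The sequence in N_p which represents [f]; it is unique because the inclusion
   of N_p in H is injective. *)
Definition sN_lift p (f : sN) : nat -> gNp G p :=
  projT1 (cid2 (sN_valP f (I : setT p))).

Definition sN_norm p (f : sN) : R := l2p_norm (sN_lift p f).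

Definition sN_ball p (f : sN) (e : R) : set sN :=
  [set g | sN_norm p (g - f) < e].

Definition sN_balls : set (set sN) :=
  [set B | exists p f e, B = sN_ball p f e].

HB.instance Definition _ := isSubBaseTopological.Build sN sN_balls id.

Lemma sN_sub_l2 (f : sN) : (f : nat -> gH G) \in @l2_pred R (gH G).
Proof.
apply/mem_set; have [g gl <-] := sN_valP f (I : setT 0%N).
move: gl; rewrite /l2p_set /l2_set /= /l2p_terms.
by under eq_fun do rewrite muln0 expr0 mul1r.
Qed.

Definition sN_to_l2 (f : sN) : l2 (gH G) := L2 (sN_sub_l2 f).

End sN.

Section sN_dual.
Context {R : realType} (G : gelfand_triple R).

Record sNdual := SNdual {
  sNdual_val :> {linear sN G -> R^o} ;
  _ : continuous (sNdual_val : sN G -> R)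
}.

Lemma sNdual0_continuous : continuous (\0%R : sN G -> R).
Proof. exact: (@cst_continuous (sN G) R 0). Qed.

HB.instance Definition _ := gen_eqMixin sNdual.
HB.instance Definition _ := gen_choiceMixin sNdual.
HB.instance Definition _ := isPointed.Build sNdual
  (@SNdual \0%R sNdual0_continuous).

Definition cylinder_sets : set (set sNdual) :=
  \bigcup_(phi in [set: sN G])
    preimage_set_system setT (fun omega : sNdual => omega phi : R) measurable.

HB.instance Definition _ := @isMeasurable.Build (sigma_display cylinder_sets) sNdual
  <<s cylinder_sets >> (@sigma_algebra0 _ setT cylinder_sets)
  (@sigma_algebraC _ cylinder_sets) (@sigma_algebra_bigcup _ setT cylinder_sets).

End sN_dual.

Section tensors.
Context {R : realType}.

Definition multilinear (V W : lmodType R) n (M : ('I_n -> V) -> W) :=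
  forall (i : 'I_n) (v : 'I_n -> V),
    linear (fun x => M (fun j => if j == i then x else v j)).

Section multiforms.
Context (V : lmodType R) (n : nat).

Definition multiform_pred : {pred (('I_n -> V) -> R^o)} :=
  mem [set F : ('I_n -> V) -> R^o | multilinear F].

Record multiform := Multiform {
  multiform_val :> ('I_n -> V) -> R^o ;
  _ : multiform_val \in multiform_pred
}.

HB.instance Definition _ := [isSub for multiform_val].
HB.instance Definition _ := [Choice of multiform by <:].

Lemma multiform_submod_closed : submod_closed multiform_pred.
Proof.
split=> [|a F F' /set_mem FP /set_mem F'P]; apply/mem_set => i v b x y.
  by rewrite /= scaler0 addr0.
rewrite !fctE FP F'P !scalerDr addrACA; congr (_ + _).
by rewrite scalerA mulrC -scalerA -scalerDr.
Qed.

HB.instance Definition _ :=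
  GRing.isSubmodClosed.Build R (('I_n -> V) -> R^o)
    multiform_pred multiform_submod_closed.
HB.instance Definition _ := [SubChoice_isSubLmodule of multiform by <:].

Lemma multiformP (F : multiform) : multilinear F.
Proof. exact: set_mem (valP F). Qed.

Lemma mperm_subproof (s : 'S_n) (F : multiform) :
  (fun v => F (v \o s) : R^o) \in multiform_pred.
Proof.
apply/mem_set => i v a x y.
have E z : (fun j => if j == i then z else v j) \o s =
    fun j => if j == (s^-1%g i) then z else (v \o s) j.
  by apply/funext => j /=; rewrite (canF_eq (permK s)).
by rewrite !E multiformP.
Qed.

Definition mperm (s : 'S_n) (F : multiform) : multiform :=
  Multiform (mperm_subproof s F).

Definition msymm (F : multiform) : multiform :=
  (n`!%:R)^-1 *: \sum_(s : 'S_n) mperm s F.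

(* Since multilinear forms separate the tensors over a field, the n-th tensor
   power of [V] is realized as a space of functions of multilinear forms: the
   elementary tensor of [v] is the evaluation at [v], and the tensor power is
   the span of the elementary tensors.  Linear functionals on it correspond to
   multilinear forms (see [tfun]), and the operations on functionals below are
   defined on the forms. *)
Definition tpow_pred : {pred (multiform -> R^o)} :=
  mem [set u : multiform -> R^o | exists s : seq (R * ('I_n -> V)),
    forall F, u F = \sum_(c <- s) c.1 * F c.2].

Record tpow := Tpow { tpow_val : multiform -> R^o ; _ : tpow_val \in tpow_pred }.

HB.instance Definition _ := [isSub for tpow_val].
HB.instance Definition _ := [Choice of tpow by <:].

Lemma tpow_submod_closed : submod_closed tpow_pred.
Proof.
split=> [|a u u' /set_mem[s us] /set_mem[s' us']]; apply/mem_set.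
  by exists [::] => F; rewrite big_nil.
exists ([seq (a * c.1, c.2) | c <- s] ++ s') => F.
rewrite !fctE us us' big_cat big_map /=; congr (_ + _).
by rewrite [LHS]mulr_sumr; apply: eq_bigr => c _; rewrite mulrA.
Qed.

HB.instance Definition _ :=
  GRing.isSubmodClosed.Build R (multiform -> R^o) tpow_pred tpow_submod_closed.
HB.instance Definition _ := [SubChoice_isSubLmodule of tpow by <:].

Lemma tpure_subproof (v : 'I_n -> V) :
  (fun F : multiform => F v : R^o) \in tpow_pred.
Proof.
by apply/mem_set; exists [:: (1, v)] => F; rewrite big_cons big_nil mul1r addr0.
Qed.

Definition tpure (v : 'I_n -> V) : tpow := Tpow (tpure_subproof v).

Definition tfun (F : multiform) (u : tpow) : R := tpow_val u F.

Definition tsymmetric (u : tpow) :=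
  forall (s : 'S_n) (F : multiform), tfun (mperm s F) u = tfun F u.

Lemma tpowP (u : tpow) : exists s : seq (R * ('I_n -> V)),
  forall F : multiform, tfun F u = \sum_(c <- s) c.1 * F c.2.
Proof. exact: set_mem (valP u). Qed.

(* For multilinear [M] this is the induced linear map; the value does not depend
   on the chosen representation of [u] (see [tmap_pure] and [tmap_linear]). *)
Definition tmap (W : lmodType R) (M : ('I_n -> V) -> W) (u : tpow) : W :=
  \sum_(c <- projT1 (cid (tpowP u))) c.1 *: M c.2.

Section tmap_hilbert.
Context (W : hilbertType R) (M : ('I_n -> V) -> W) (Mlin : multilinear M).

Lemma inner_multilinear (w : W) :
  (fun v => inner w (M v) : R^o) \in multiform_pred.
Proof. by apply/mem_set => i v a x y; rewrite Mlin linearPr. Qed.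

Lemma inner_tmap (w : W) (u : tpow) :
  inner w (tmap M u) = tfun (Multiform (inner_multilinear w)) u.
Proof.
rewrite /tmap; case: cid => s /= ->; rewrite raddf_sum.
by apply: eq_bigr => c _; rewrite /= linearZr.
Qed.

Lemma hilbert_ext (x y : W) : (forall w, inner w x = inner w y) -> x = y.
Proof.
move=> h; apply/eqP; rewrite -subr_eq0 -normr_eq0 -sqrf_eq0 -inner_norm.
by rewrite linearBr /= h subrr.
Qed.

Lemma tmap_pure (v : 'I_n -> V) : tmap M (tpure v) = M v.
Proof. by apply: hilbert_ext => w; rewrite inner_tmap. Qed.

Lemma tmap_linear : linear (tmap M).
Proof.
move=> a u u'; apply: hilbert_ext => w.
by rewrite linearPr /= inner_tmap (inner_tmap w u) (inner_tmap w u').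
Qed.

End tmap_hilbert.
End multiforms.

Lemma mtensor_subproof (V : lmodType R) p q
    (F : multiform V p) (F' : multiform V q) :
  (fun v : 'I_(p + q) -> V => F (v \o @lshift p q) * F' (v \o @rshift p q) : R^o)
    \in @multiform_pred V (p + q).
Proof.
apply/mem_set => i v a x y.
rewrite -(splitK i); case: (fintype.split i) => k /=.
  have El z : (fun j => if j == lshift q k then z else v j) \o @lshift p q =
      fun j => if j == k then z else (v \o @lshift p q) j.
    by apply/funext => j /=; rewrite eq_lshift.
  have Er z : (fun j => if j == lshift q k then z else v j) \o @rshift p q =
      v \o @rshift p q.
    by apply/funext => j /=; rewrite eq_rlshift.
  by rewrite !El !Er (multiformP F) mulrDl scalerAl.
have El z : (fun j => if j == rshift p k then z else v j) \o @lshift p q =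
    v \o @lshift p q.
  by apply/funext => j /=; rewrite eq_lrshift.
have Er z : (fun j => if j == rshift p k then z else v j) \o @rshift p q =
    fun j => if j == k then z else (v \o @rshift p q) j.
  by apply/funext => j /=; rewrite eq_rshift.
by rewrite !El !Er (multiformP F') mulrDr scalerAr.
Qed.

Definition mtensor (V : lmodType R) p q (F : multiform V p) (F' : multiform V q)
  : multiform V (p + q) := Multiform (mtensor_subproof F F').

Definition mtensor_sym (V : lmodType R) p q
    (F : multiform V p) (F' : multiform V q) : multiform V (p + q) :=
  msymm (mtensor F F').

Lemma mone_subproof (V : lmodType R) :
  (fun=> 1 : R^o) \in @multiform_pred V 0.
Proof. by apply/mem_set => -[]. Qed.

Definition mone (V : lmodType R) : multiform V 0 := Multiform (mone_subproof V).

Lemma mlin_subproof (V : lmodType R) (L : {linear V -> R^o}) :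
  (fun v : 'I_1 -> V => L (v ord0)) \in @multiform_pred V 1.
Proof. by apply/mem_set => i v a x y; rewrite (ord1 i) /= linearP. Qed.

Definition mlin (V : lmodType R) (L : {linear V -> R^o}) : multiform V 1 :=
  Multiform (mlin_subproof L).

End tensors.

Section l2_operators.
Context {R : realType} (V : hilbertType R).

Lemma innerC (x y : V) : inner x y = inner y x.
Proof. by rewrite hermC expr0 mul1r. Qed.

Lemma inner_polar (x y : V) :
  inner x y = 2^-1 * (`|x + y| ^+ 2 - `|x| ^+ 2 - `|y| ^+ 2).
Proof.
rewrite -!inner_norm linearDl /= !linearDr /= (innerC y x).
by field.
Qed.

Lemma l2_inner_cvg (f g : l2 V) :
  cvgn (series (fun k => inner (f k) (g k) : R)).
Proof.
have cl (h : l2 V) : cvgn (series (fun k => `|h k| ^+ 2 : R)).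
  exact: (set_mem (valP h)).
have -> : (fun k => inner (f k) (g k) : R) =
    2^-1 *: ((fun k => `|(f + g) k| ^+ 2) - (fun k => `|f k| ^+ 2)
             - (fun k => `|g k| ^+ 2)).
  by apply/funext => k; rewrite inner_polar.
by apply: is_cvg_seriesZ; apply: is_cvg_seriesB => //; apply: is_cvg_seriesB.
Qed.

Lemma l2_innerC (f g : l2 V) : l2_inner f g = l2_inner g f.
Proof. by rewrite /l2_inner; under eq_fun do rewrite innerC. Qed.

Lemma l2_inner_linear (h : l2 V) : linear (fun f => l2_inner f h : R^o).
Proof.
move=> a f g; rewrite /l2_inner.
have -> : (fun k => inner ((a *: f + g) k) (h k) : R) =
    a *: (fun k => inner (f k) (h k)) + (fun k => inner (g k) (h k)).
  by apply/funext => k; rewrite linearPl.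
have cf := @l2_inner_cvg f h; have cg := @l2_inner_cvg g h.
by rewrite (lim_seriesD (is_cvg_seriesZ (k := a) cf) cg) (lim_seriesZ _ cf).
Qed.

Definition bounded_op (A : l2 V -> l2 V) := exists C : R,
  forall f, ipnorm (@l2_inner _ V) (A f) <= C * ipnorm (@l2_inner _ V) f.

Definition selfadjoint_op (A : l2 V -> l2 V) :=
  forall f g, l2_inner (A f) g = l2_inner f (A g).

Definition posdef_op (A : l2 V -> l2 V) :=
  forall f, f <> 0 -> 0 < l2_inner f (A f).

Definition A_inner (A : l2 V -> l2 V) (f g : l2 V) : R := l2_inner f (A g).

End l2_operators.

Section wick.
Context {R : realType} (G : gelfand_triple R).
Variable A : {linear l2 (gH G) -> l2 (gH G)}.

Lemma tauA_subproof :
  (fun v : 'I_2 -> sN G =>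
     A_inner A (sN_to_l2 (v ord0)) (sN_to_l2 (v ord_max)) : R^o)
    \in @multiform_pred R (sN G) 2.
Proof.
have sl : linear (@sN_to_l2 R G) by move=> a f g; exact/val_inj.
apply/mem_set => i v a x y; rewrite /A_inner.
have [->|->] : i = ord0 \/ i = ord_max.
  by case: i => -[|[|//]] ?; [left|right]; exact/val_inj.
  by rewrite /= sl l2_inner_linear.
by rewrite /= sl linearP !(l2_innerC (sN_to_l2 (v ord0))) l2_inner_linear.
Qed.

Definition tauA : multiform (sN G) 2 := Multiform tauA_subproof.

Fixpoint wick_pair (omega : sNdual G) n : multiform (sN G) n * multiform (sN G) n.+1 :=
  if n is m.+1 then
    let w := wick_pair omega m in
    (w.2, mtensor_sym (mlin omega) w.2 - m.+1%:R *: mtensor_sym tauA w.1)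
  else (mone (sN G), mlin omega).

Definition wick_form (omega : sNdual G) n : multiform (sN G) n :=
  (wick_pair omega n).1.

Lemma wick_form0 omega : wick_form omega 0 = mone (sN G).
Proof. by []. Qed.

Lemma wick_form1 omega : wick_form omega 1 = mlin omega.
Proof. by []. Qed.

Lemma wick_formSS omega n : wick_form omega n.+2 =
  mtensor_sym (mlin omega) (wick_form omega n.+1)
  - n.+1%:R *: mtensor_sym tauA (wick_form omega n).
Proof. by []. Qed.

Definition wick n (u : tpow (sN G) n) (omega : sNdual G) : R :=
  tfun (wick_form omega n) u.

End wick.

Section gaussian.
Context {R : realType} (G : gelfand_triple R).
Variable A : {linear l2 (gH G) -> l2 (gH G)}.

(* The real and the imaginary part of the characteristic function. *)
Definition gaussian_measure (mu : probability (sNdual G) R) :=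
  forall phi : sN G,
    \int[mu]_omega cos (omega phi : R) =
      expR (- 2^-1 * A_inner A (sN_to_l2 phi) (sN_to_l2 phi)) /\
    \int[mu]_omega sin (omega phi : R) = 0.

End gaussian.

Section L2.
Context {R : realType} d (T : measurableType d) (mu : probability T R).

Definition L2_limit (F : nat -> T -> R) (X : T -> R) :=
  X \in Lfun mu 2%:E /\
  ('N[mu]_2%:E[EFin \o (F k \- X)%R])%E @[k --> \oo] --> 0%E.

(* [Y] is a version, up to [mu]-null sets, of E[X | GG]. *)
Definition is_cond_expectation (GG : set (set T)) (X Y : T -> R) :=
  exists Z : T -> R,
    [/\ Z = Y %[ae mu],
        forall B : set R, measurable B -> GG (Z @^-1` B),
        mu.-integrable setT (EFin \o Z)
      & forall C, GG C -> \int[mu]_(x in C) Z x = \int[mu]_(x in C) X x].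

End L2.

Section hilbert_tensor.
Context {R : realType} (V : hilbertType R) (n : nat) (W : hilbertType R).
Variable t : ('I_n -> V) -> W.

(* [W], with [t v] the elementary tensor of the v_i, is the completion of the
   n-th algebraic tensor power of [V]. *)
Definition is_hilbert_tensor_power :=
  [/\ multilinear t,
      forall v w, inner (t v) (t w) = \prod_(i < n) inner (v i) (w i)
    & dense (lspan (range t))].

Definition symmetric_tensors : set W :=
  closure (lspan (range (fun f : V => t (fun=> f)))).

Definition is_tensor_power_op (L : V -> V) (Ln : W -> W) :=
  [/\ linear Ln, continuous Ln & forall v, Ln (t v) = t (L \o v)].

End hilbert_tensor.

Definition orth_proj (R : realType) (V : hilbertType R) m (psi : 'I_m -> V)
  (f : V) : V := \sum_(k < m) inner f (psi k) *: psi k.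

Section wick_L2.
Context {R : realType} (G : gelfand_triple R).
Variable A : {linear l2 (gH G) -> l2 (gH G)}.
Variable mu : probability (sNdual G) R.
Context (LA : hilbertType R) (J : l2 (gH G) -> LA).

(* [X] represents the element <f, .> of L^2(mu).  As the limit is the same for all
   approximating sequences, it suffices to have one; likewise for [is_wick]. *)
Definition is_pairing (f : LA) (X : sNdual G -> R) :=
  exists phi : nat -> sN G,
    J (sN_to_l2 (phi k)) @[k --> \oo] --> f /\
    L2_limit mu (fun k omega => omega (phi k)) X.

Definition sN_tensor n (W : hilbertType R) (t : ('I_n -> LA) -> W) :
  tpow (sN G) n -> W := tmap (fun v => t (fun i => J (sN_to_l2 (v i)))).

(* [X] represents the element <f, :omega^(tensor n):> of L^2(mu). *)
Definition is_wick n (W : hilbertType R) (t : ('I_n -> LA) -> W) (f : W)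
    (X : sNdual G -> R) :=
  exists phi : nat -> tpow (sN G) n,
    [/\ forall k, tsymmetric (phi k),
        sN_tensor t (phi k) @[k --> \oo] --> f
      & L2_limit mu (fun k => wick A (phi k)) X].

End wick_L2.

(* Main.v *)
(* On the diagonal the Wick power of omega is a Hermite polynomial of omega(phi),
   so integration by parts for Gaussian variables and polarization give, for
   every y = <eta, .> in the closure of the linear functionals and any f,
     E[<f, :.^n:> exp (i y)] = i^n (f, eta^(tensor n)) exp (- |eta|^2 / 2).
   For eta in span psi the right-hand side does not change when f is replaced
   by P^(tensor n) f.  Since P^(tensor n) f is a combination of tensors of the
   psi_k, there is a polynomial Z in the variables <psi_k, .> with the transform
   of <P^(tensor n) f, :.^n:> for all eta.  An integrable variable is determined
   by such integrals, hence Z = <P^(tensor n) f, :.^n:> almost surely, and Z has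
   the same integrals as <f, :.^n:> over the sets of the sigma-algebra
   generated by the <psi_k, .>. *)

Require Import Defs.
From HB Require Import structures.
From mathcomp Require Import all_boot all_order perm all_algebra.
From mathcomp Require Import all_classical all_reals all_analysis.
From mathcomp Require Import measurable_realfun ring lra.

Set Implicit Arguments.
Unset Strict Implicit.
Unset Printing Implicit Defensive.

Import Order.TTheory GRing.Theory Num.Theory.
Import numFieldNormedType.Exports.

Local Open Scope classical_set_scope.
Local Open Scope ring_scope.

(** * Polarization *)

Section polarization.
Context {R : realType}.

(** The measure is known only through integrals of cosines and sines of linear functionals, so that
    even the integrability of Hermite polynomials has to be extracted from them. The moments
    therefore come out of the very transform that presupposes them, by an induction that gains two
    orders at a time. All transforms stay real: a free phase t in cos (y + t) carries the real and
    the imaginary part at once, and the factor i^n becomes a shift of t by n pi / 2. The variables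
    <psi_k, .> and <phi, .>, phi in s(N), are treated as one jointly Gaussian family: the <phi, .>
    generate the whole sigma-algebra and so decide the equality of Z and the projected Wick power,
    while Z is written in the given representatives of the <psi_k, .>, which makes it measurable for
    their sigma-algebra and not merely up to null sets. *)

Lemma linear_combination (V W : lmodType R) (L : V -> W) (L_linear : linear L)
    (I : Type) (r : seq I) (c : I -> R) (x : I -> V) :
  L (\sum_(i <- r) c i *: x i) = \sum_(i <- r) c i *: L (x i).
Proof.
elim: r => [|i r IHr]; last by rewrite !big_cons L_linear IHr.
rewrite !big_nil; have := L_linear (-1) 0 0.
by rewrite scaler0 addr0 scaleN1r addNr.
Qed.

Lemma multilinear_expand (V W : lmodType R) m n (M : ('I_n -> V) -> W)
    (c : 'I_n -> 'I_m -> R) (w : 'I_m -> V) : multilinear M ->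
  M (fun j => \sum_i c j i *: w i) =
  \sum_(g : {ffun 'I_n -> 'I_m}) (\prod_j c j (g j)) *: M (w \o g).
Proof.
elim: n M c => [|n IHn] M c Mlin.
  rewrite (big_pred1 (ffun0 (card_ord 0))) => [|g]; last first.
    by apply/esym/eqP/ffunP => -[].
  by rewrite big_ord0 scale1r; congr M; apply/funext => -[].
(* [M1 x] is [M] with [x] in slot 0, since [unlift ord0 j] is [None] exactly at j = ord0; the
   induction runs over the remaining slots. *)
pose M1 x (v : 'I_n -> V) := M (fun j => oapp v x (unlift ord0 j)).
have M1lin x : multilinear (M1 x).
  move=> i v a y z; rewrite /M1.
  have E u : (fun j => oapp (fun j => if j == i then u else v j) x (unlift ord0 j)) =
      (fun j => if j == lift ord0 i then u else oapp v x (unlift ord0 j)).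
    apply/funext => j; case: unliftP => [k ->|->] /=.
      by rewrite (inj_eq lift_inj).
    by [].
  by rewrite /= !E Mlin.
have -> : M (fun j => \sum_i c j i *: w i) =
    \sum_i c ord0 i *: M1 (w i) (fun j => \sum_i c (lift ord0 j) i *: w i).
  have := linear_combination (Mlin ord0 (fun j => \sum_i c j i *: w i))
    (index_enum 'I_m) (c ord0) w.
  move=> /= E; rewrite (_ : (fun j => _) = fun j =>
    if j == ord0 then \sum_i c ord0 i *: w i else \sum_i c j i *: w i); last first.
    by apply/funext => j; case: eqP => [->|].
  rewrite E; apply: eq_bigr => i _; congr (_ *: M _); apply/funext => j.
  by case: unliftP => [k ->|->].
under eq_bigr do rewrite (IHn _ (fun j => c (lift ord0 j)) (M1lin _)) scaler_sumr.
rewrite pair_bigA /=.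
pose h (p : 'I_m * {ffun 'I_n -> 'I_m}) : {ffun 'I_n.+1 -> 'I_m} :=
  [ffun j => oapp p.2 p.1 (unlift ord0 j)].
pose k (g : {ffun 'I_n.+1 -> 'I_m}) :=
  (g ord0, [ffun j => g (lift ord0 j)] : {ffun 'I_n -> 'I_m}).
rewrite [RHS](reindex h) /=; last first.
  exists k => [[i g] _|g _]; rewrite /k /h.
    congr pair; first by rewrite ffunE unlift_none.
    by apply/ffunP => j; rewrite !ffunE liftK.
  by apply/ffunP => j; rewrite !ffunE; case: unliftP => [l|] -> //=; rewrite ffunE.
apply: eq_bigr => -[i g] _ /=; rewrite scalerA big_ord_recl; congr (_ * _ *: M _).
- by rewrite ffunE unlift_none.
- by apply: eq_bigr => j _; rewrite ffunE liftK.
- by apply/funext => j /=; rewrite ffunE; case: unliftP.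
Qed.

(** Inclusion-exclusion over subsets e: after expansion, F (v \o g) carries the signed count of the
    subsets containing the image of g, which is zero unless g is onto, hence a permutation. *)
Lemma polarization (V : lmodType R) n (F : multiform V n) (v : 'I_n -> V) :
  \sum_(e : {ffun 'I_n -> bool})
    (\prod_i (-1) ^+ (~~ e i)) * F (fun=> \sum_i (e i)%:R *: v i) =
  \sum_(s : 'S_n) F (v \o s).
Proof.
under eq_bigr => e _.
  rewrite (multilinear_expand (fun=> fun i => (e i)%:R) v (multiformP F)) mulr_sumr.
  over.
rewrite exchange_big /=.
have E (g : {ffun 'I_n -> 'I_n}) :
    \sum_(e : {ffun 'I_n -> bool}) (\prod_i (-1) ^+ (~~ e i)) *
      ((\prod_j (e (g j))%:R) *: F (v \o g)) = (injectiveb g)%:R * F (v \o g).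
  under eq_bigr do rewrite [_ *: _]/(_ * _) mulrA.
  rewrite -mulr_suml; congr (_ * _).
  (* [K i b] is what the summand contributes at i, so that the sum over e turns into a product of
     sums over b; an i missed by g gives the factor 1 - 1. *)
  pose K i (b : bool) : R := (-1) ^+ (~~ b) * (if i \in codom g then b%:R else 1).
  have -> : \sum_(e : {ffun 'I_n -> bool}) (\prod_i (-1) ^+ (~~ e i)) * (\prod_j (e (g j))%:R) =
      \sum_(e : {ffun 'I_n -> bool}) \prod_i K i (e i).
    apply: eq_bigr => e _; rewrite /K big_split /=; congr (_ * _).
    rewrite -big_mkcond /=.
    have natb (I : finType) (P : pred I) (b : I -> bool) :
        \prod_(i | P i) (b i)%:R = ([forall (i | P i), b i])%:R :> R.
      have [/forallP h|/forallPn[i]] := boolP [forall (i | P i), b i].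
        by rewrite big1// => i Pi; have := h i; rewrite Pi => /= ->.
      by rewrite negb_imply => /andP[Pi /negbTE bi]; rewrite (bigD1 i)//= bi mul0r.
    rewrite !natb; congr (nat_of_bool _)%:R; apply/forallP/forallP => /= h i.
      by apply/implyP => /codomP[j ->]; exact: h.
    by have := h (g i); rewrite codom_f.
  rewrite -(bigA_distr_bigA K).
  have [ginj|gninj] := boolP (injectiveb g).
    rewrite big1// => i _; rewrite big_bool /K /=.
    have -> : i \in codom g by exact: injF_onto (injectiveP _ ginj) i.
    by rewrite mulr1 mulr0 addr0 expr0.
  have [i gi] : exists i, i \notin codom g.
    apply/existsP; rewrite -negb_forall; apply: contra gninj => /forallP h.
    suff /image_injP gi : #|fintype.image g predT| == #|predT : pred 'I_n|.
      by apply/injectiveP => x y; exact: gi.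
    rewrite eqn_leq leq_image_card /=.
    by apply: subset_leq_card; apply/fintype.subsetP => z _; exact: h.
  rewrite (bigD1 i)//= big_bool /K (negbTE gi) !mulr1 /= expr0 expr1.
  by rewrite subrr mul0r.
rewrite (eq_bigr _ (fun g _ => E g)).
rewrite (bigID (fun g : {ffun _} => injectiveb g)) /= [X in _ + X]big1 ?addr0; last first.
  by move=> g /negbTE ->; rewrite mul0r.
(* The default value of [insubd] is never reached, as g is injective here. *)
rewrite (reindex_onto (fun s : 'S_n => pval s) (fun g => insubd (1%g : 'S_n) g)) /=; last first.
  by move=> g gi; rewrite insubdK.
apply: eq_big => s.
  by rewrite (valP s) valKd eqxx.
by case/andP => /= -> _; rewrite mul1r; congr (F _); apply/funext => i /=; rewrite pvalE.
Qed.

End polarization.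

(** * Uniqueness of Fourier transforms *)

Section expectation.
Context {R : realType} d {T : measurableType d} (mu : probability T R).
Implicit Types f g h : T -> R.

Local Notation L1 f := (mu.-integrable [set: T] (EFin \o f)).

Lemma L1_measurable f : L1 f -> measurable_fun [set: T] f.
Proof. by move=> /measurable_int /measurable_EFinP. Qed.

Lemma L1_le f g : measurable_fun [set: T] f -> L1 g ->
  (forall x, `|f x| <= `|g x|) -> L1 f.
Proof.
move=> mf ig fg; apply: (le_integrable measurableT _ _ ig).
  exact/measurable_EFinP.
by move=> x _; rewrite /= lee_fin.
Qed.

Lemma L1_cst r : L1 (cst r).
Proof. exact: finite_measure_integrable_cst. Qed.

Lemma L1D f g : L1 f -> L1 g -> L1 (fun x => f x + g x).
Proof. by move=> fi gi; have := integrableD measurableT fi gi. Qed.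

Lemma L1Z r f : L1 f -> L1 (fun x => r * f x).
Proof. by move=> fi; have := integrableZl measurableT r fi. Qed.

Lemma L1B f g : L1 f -> L1 g -> L1 (fun x => f x - g x).
Proof.
move=> fi gi; have := L1D fi (L1Z (-1) gi).
by under eq_fun do rewrite mulN1r.
Qed.

Lemma L1_norm f : L1 f -> L1 (fun x => `|f x|).
Proof. by move=> fi; have := integrable_abse fi. Qed.

Lemma L1_sum (I : Type) (r : seq I) (f : I -> T -> R) :
  (forall i, L1 (f i)) -> L1 (fun x => \sum_(i <- r) f i x).
Proof.
move=> fi; elim: r => [|i r IHr].
  by under eq_fun do rewrite big_nil; exact: L1_cst.
by under eq_fun do rewrite big_cons; exact: L1D.
Qed.

Lemma L1_bounded f g C : L1 f -> measurable_fun [set: T] g ->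
  (forall x, `|g x| <= C) -> L1 (fun x => f x * g x).
Proof.
move=> fi mg gC; apply: L1_le (L1Z C fi) _ => [|x].
  by apply: measurable_funM => //; exact: L1_measurable.
by rewrite mulrC !normrM ler_wpM2r// (le_trans (gC x))// ler_norm.
Qed.

Lemma Rintegral_sum (I : Type) (r : seq I) (c : I -> R) (f : I -> T -> R) :
  (forall i, L1 (f i)) ->
  \int[mu]_x (\sum_(i <- r) c i * f i x) = \sum_(i <- r) c i * \int[mu]_x f i x.
Proof.
move=> fi; elim: r => [|i r IHr].
  under eq_Rintegral do rewrite big_nil.
  by rewrite big_nil Rintegral_cst// mul0r.
under eq_Rintegral do rewrite big_cons.
rewrite big_cons RintegralD// ?IHr ?RintegralZl//; first exact: L1Z.
by apply: L1_sum => j; exact: L1Z.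
Qed.

Lemma expectation_cst r : \int[mu]_x r = r.
Proof. by rewrite Rintegral_cst// [X in fine X](@probability_setT _ _ _ mu) mulr1. Qed.

Lemma Rintegral_dominated (f_ : nat -> T -> R) f g :
  (forall n, measurable_fun [set: T] (f_ n)) ->
  (forall x, f_ n x @[n --> \oo] --> f x) -> L1 g ->
  (forall n x, `|f_ n x| <= g x) ->
  \int[mu]_x f_ n x @[n --> \oo] --> \int[mu]_x f x.
Proof.
move=> mf_ f_f gi fg.
have mf : measurable_fun [set: T] f by apply: measurable_fun_cvg mf_ _ => x _; exact: f_f.
have [|||||fi _ h] := @dominated_convergence _ _ _ mu _ measurableT
  (fun n => EFin \o f_ n) (EFin \o f) (EFin \o g).
- by move=> n; exact/measurable_EFinP.
- exact/measurable_EFinP.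
- by apply: aeW => x _ /=; apply: cvg_EFin; [exact: nearW|exact: f_f].
- exact: gi.
- by apply: aeW => x n _ /=; rewrite lee_fin.
by apply: fine_cvg; rewrite /Rintegral fineK//; exact: integrable_fin_num.
Qed.

Lemma Rintegral_eq0_limit (f_ : nat -> T -> R) f g :
  (forall n, measurable_fun [set: T] (f_ n)) ->
  (forall x, f_ n x @[n --> \oo] --> f x) -> L1 g ->
  (forall n x, `|f_ n x| <= g x) -> (forall n, \int[mu]_x f_ n x = 0) ->
  \int[mu]_x f x = 0.
Proof.
move=> mf_ f_f gi fg f0; have := Rintegral_dominated mf_ f_f gi fg.
by rewrite (_ : (fun n => _) = cst 0); [move=> /cvg_lim <-//; rewrite lim_cst|exact/funext].
Qed.

Lemma Rintegral_indic f A : \int[mu]_(x in A) f x = \int[mu]_x (f x * \1_A x).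
Proof. by rewrite Rintegral_mkcond patch_indic. Qed.

End expectation.

Section smoothstep.
Context {R : realType}.

(* The fixed points -1 and 1 of s |-> (3 s - s^3) / 2 attract ]-1, 0[ and ]0, 1[, so
   these polynomials converge pointwise on [-1, 1] to the sign function. *)
Definition smoothstep n : {poly R} :=
  iter n (fun p => (3 / 2)%:P * p - (2^-1)%:P * p ^+ 3) 'X.

Lemma smoothstepS n (s : R) : (smoothstep n.+1).[s] =
  (3 * (smoothstep n).[s] - (smoothstep n).[s] ^+ 3) / 2.
Proof.
rewrite /smoothstep iterS -/(smoothstep n) hornerD hornerN !hornerCM horner_exp.
by field.
Qed.

Lemma smoothstepN n (s : R) : (smoothstep n).[- s] = - (smoothstep n).[s].
Proof.
elim: n => [|n IHn]; first by rewrite /= !hornerE.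
by rewrite !smoothstepS IHn; field.
Qed.

(** From 2 - 3 u + u^3 = (1 - u)^2 (2 + u) = (1 - u) (2 - u - u^2): the iterates stay below 1, and
    as they increase from s, each step shrinks 1 - u at least by the factor 1 - s / 2. *)
Lemma smoothstep_gt0 n (s : R) : 0 < s -> s <= 1 ->
  s <= (smoothstep n).[s] <= 1 /\ 1 - (smoothstep n).[s] <= (1 - s / 2) ^+ n.
Proof.
move=> s0 s1; elim: n => [|n [/andP[IH1 IH2] IH3]].
  by rewrite expr0 /= !hornerE lexx s1; split => //; lra.
rewrite smoothstepS; set u := (smoothstep n).[s] in IH1 IH2 IH3 *.
have u0 : 0 <= u by lra.
have u1 : 0 <= 1 - u by lra.
have h1 : 0 <= u * ((1 - u) * (1 + u)) by rewrite !mulr_ge0//; lra.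
have h2 : 0 <= (1 - u) ^+ 2 * (2 + u) by rewrite mulr_ge0 ?sqr_ge0//; lra.
have h3 : 0 <= (1 - u) * (u - s) by rewrite mulr_ge0//; lra.
have h4 : 0 <= (1 - u) * u ^+ 2 by rewrite mulr_ge0 ?sqr_ge0.
split; first by apply/andP; split; lra.
rewrite [leRHS]exprS; apply: (@le_trans _ _ ((1 - s / 2) * (1 - u))); first by lra.
by apply: ler_wpM2l => //; lra.
Qed.

Lemma smoothstep_cvg (s : R) : `|s| <= 1 -> (smoothstep n).[s] @[n --> \oo] --> Num.sg s.
Proof.
have pos (r : R) : 0 < r -> r <= 1 -> (smoothstep n).[r] @[n --> \oo] --> (1 : R).
  move=> r0 r1; apply: (@squeeze_cvgr _ _ _ _ (fun n => 1 - (1 - r / 2) ^+ n) (cst 1)).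
  - apply: nearW => n; have [/andP[_ h1] h2] := smoothstep_gt0 n r0 r1.
    by rewrite h1 andbT; lra.
  - rewrite -[X in _ --> X]subr0; apply: cvgB; first exact: cvg_cst.
    by apply: cvg_expr; rewrite ger0_norm; lra.
  - exact: cvg_cst.
have [s0|s0|->] := ltgtP s 0; rewrite ?sgr0.
- rewrite ltr0_norm// ltr0_sg// => s1; rewrite -[s]opprK.
  under eq_fun do rewrite smoothstepN; apply: cvgN; apply: pos => //.
  by rewrite oppr_gt0.
- by rewrite gtr0_norm// gtr0_sg// => s1; exact: pos.
- move=> _; rewrite (_ : (fun n => _) = cst 0); first exact: cvg_cst.
  apply/funext => n; have := smoothstepN n 0; rewrite oppr0 => /eqP.
  by rewrite -addr_eq0 -mulr2n mulrn_eq0 /= => /eqP.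
Qed.

Lemma smoothstep_le1 n (s : R) : `|s| <= 1 -> `|(smoothstep n).[s]| <= 1.
Proof.
elim: n => [|n IHn] s1; first by rewrite /= hornerE.
move: (IHn s1); rewrite smoothstepS; set u := (smoothstep n).[s].
rewrite !ler_norml => /andP[h1 h2].
have h3 : 0 <= (1 - u) ^+ 2 * (2 + u) by rewrite mulr_ge0 ?sqr_ge0//; lra.
have h4 : 0 <= (1 + u) ^+ 2 * (2 - u) by rewrite mulr_ge0 ?sqr_ge0//; lra.
by apply/andP; split; lra.
Qed.

End smoothstep.

(** * From integrals against cosines to integrals over sets *)

Section fourier_uniqueness.
Context {R : realType} d {T : measurableType d} (mu : probability T R).
Implicit Types (f g h D x y : T -> R).

Local Notation L1 f := (mu.-integrable [set: T] (EFin \o f)).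

Lemma measurable_cos_comp f : measurable_fun [set: T] f ->
  measurable_fun [set: T] (fun w => cos (f w)).
Proof.
move=> mf; apply: measurableT_comp => //; apply: continuous_measurable_fun.
exact: continuous_cos.
Qed.

Lemma measurable_sin_comp f : measurable_fun [set: T] f ->
  measurable_fun [set: T] (fun w => sin (f w)).
Proof.
move=> mf; apply: measurableT_comp => //; apply: continuous_measurable_fun.
exact: continuous_sin.
Qed.

Lemma measurable_affine a b x : measurable_fun [set: T] x ->
  measurable_fun [set: T] (fun w => a * x w + b).
Proof. by move=> mx; apply: measurable_funD => //; exact: measurable_funM. Qed.

Lemma L1_cos f g : L1 f -> measurable_fun [set: T] g -> L1 (fun w => f w * cos (g w)).
Proof.
move=> fi mg; apply: (L1_bounded fi (measurable_cos_comp mg) (C := 1)) => w.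
exact: cos_max.
Qed.

Lemma measurable_sg : measurable_fun [set: R] (Num.sg : R -> R).
Proof.
rewrite (_ : Num.sg = fun r : R => \1_`]0, +oo[ r - \1_`]-oo, 0[ r).
  by apply: measurable_funB; exact: measurable_indic.
apply/funext => r; rewrite !indicE !mem_setE !in_itv /= andbT.
case: (ltgtP r 0) => [r0|r0|->]; last by rewrite sgr0 subrr.
  by rewrite ltr0_sg// sub0r.
by rewrite gtr0_sg// subr0.
Qed.

Lemma sin_mul_cos (u v : R) :
  sin u * cos v = 2^-1 * cos (u + v - pi / 2) + 2^-1 * cos (u - v - pi / 2).
Proof. by rewrite !cosBpihalf sinD sinB; field. Qed.

Lemma cos_mul_cos (u v : R) :
  cos u * cos v = 2^-1 * cos (u + v) + 2^-1 * cos (u - v).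
Proof. by rewrite cosD cosB; field. Qed.

Section one_variable.
Variables (D x : T -> R).
Hypotheses (D_L1 : L1 D) (x_meas : measurable_fun [set: T] x).
Hypothesis D_cos : forall a b, \int[mu]_w (D w * cos (a * x w + b)) = 0.

Let msin a b : measurable_fun [set: T] (fun w => sin (a * x w + b)).
Proof. exact/measurable_sin_comp/measurable_affine. Qed.

Let D_mean : \int[mu]_w D w = 0.
Proof.
rewrite -(D_cos 0 0); apply: eq_Rintegral => w _.
by rewrite mul0r addr0 cos0 mulr1.
Qed.

(** Multiplying a cosine of frequency a by the sine gives cosines of frequencies c + a and c - a, so
    the induction on p has to keep all a and b. *)
Lemma Rintegral_poly_sin_cos (p : {poly R}) c e :
  L1 (fun w => D w * p.[sin (c * x w + e)]) /\
  forall a b, \int[mu]_w (D w * p.[sin (c * x w + e)] * cos (a * x w + b)) = 0.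
Proof.
elim/poly_ind: p => [|p k [IHi IH]].
  split=> [|a b].
    by under eq_fun do rewrite horner0 mulr0; exact: L1_cst.
  by under eq_Rintegral do rewrite horner0 mulr0 mul0r; rewrite expectation_cst.
have E w : D w * (p * 'X + k%:P).[sin (c * x w + e)] =
    D w * p.[sin (c * x w + e)] * sin (c * x w + e) + k * D w.
  by rewrite hornerMXaddC; ring.
have Lp : L1 (fun w => D w * p.[sin (c * x w + e)] * sin (c * x w + e)).
  by apply: (L1_bounded IHi (msin c e) (C := 1)) => w; exact: sin_max.
split=> [|a b].
  by under eq_fun do rewrite E; apply: L1D => //; exact: L1Z.
transitivity (\int[mu]_w (
    (2^-1 * (D w * p.[sin (c * x w + e)] * cos ((c + a) * x w + (e + b - pi / 2))) +
     2^-1 * (D w * p.[sin (c * x w + e)] * cos ((c - a) * x w + (e - b - pi / 2)))) +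
     k * (D w * cos (a * x w + b)))).
  apply: eq_Rintegral => w _; rewrite E mulrDl -mulrA sin_mul_cos.
  rewrite (_ : _ + _ - pi / 2 = (c + a) * x w + (e + b - pi / 2)); last by ring.
  rewrite (_ : _ - _ - pi / 2 = (c - a) * x w + (e - b - pi / 2)); last by ring.
  by ring.
have Lc a' b' : L1 (fun w => D w * p.[sin (c * x w + e)] * cos (a' * x w + b')).
  exact/L1_cos/measurable_affine.
have LD : L1 (fun w => D w * cos (a * x w + b)) by exact/L1_cos/measurable_affine.
rewrite RintegralD//; [|by apply: L1D; exact: L1Z|exact: L1Z].
rewrite RintegralD//; [|exact: L1Z..].
by rewrite !RintegralZl// !IH D_cos !mulr0 !addr0.
Qed.

(** The [smoothstep] polynomials of the sine are bounded by 1 and tend to its sign, so dominated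
    convergence applies with bound |D|. *)
Lemma Rintegral_sg_sin c e : \int[mu]_w (D w * Num.sg (sin (c * x w + e))) = 0.
Proof.
apply: (@Rintegral_eq0_limit _ _ _ mu
    (fun n w => D w * (smoothstep n).[sin (c * x w + e)]) _ (fun w => `|D w|)).
- by move=> n; have [+ _] := Rintegral_poly_sin_cos (smoothstep n) c e => /L1_measurable.
- by move=> w; apply: cvgM; [exact: cvg_cst|exact/smoothstep_cvg/sin_max].
- exact: L1_norm.
- by move=> n w; rewrite normrM ler_piMr//; exact/smoothstep_le1/sin_max.
- move=> n; have [_ /(_ 0 0) <-] := Rintegral_poly_sin_cos (smoothstep n) c e.
  by apply: eq_Rintegral => w _; rewrite mul0r addr0 cos0 mulr1.
Qed.

Let sg_sin (y : R) : `|y| < pi -> Num.sg (sin y) = Num.sg y.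
Proof.
have pos (z : R) : 0 < z -> z < pi -> Num.sg (sin z) = 1.
  by move=> z0 zpi; rewrite gtr0_sg// sin_gt0_pi// z0.
have [y0|y0|->] := ltgtP y 0; last by rewrite sin0.
  rewrite ltr0_norm// => ypi.
  by rewrite -[in LHS](opprK y) sinN sgrN pos ?oppr_gt0// ltr0_sg.
by rewrite gtr0_norm// => ypi; rewrite pos// gtr0_sg.
Qed.

(* sin ((x - c) / (n + 1)) has the sign of x - c as soon as n is large. *)
Lemma Rintegral_sg c : \int[mu]_w (D w * Num.sg (x w - c)) = 0.
Proof.
apply: (@Rintegral_eq0_limit _ _ _ mu
    (fun n w => D w * Num.sg (sin (n.+1%:R^-1 * x w + - n.+1%:R^-1 * c))) _ (fun w => `|D w|)).
- move=> n; apply: measurable_funM; first exact: L1_measurable D_L1.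
  exact: measurableT_comp measurable_sg _.
- move=> w; apply: cvgM; first exact: cvg_cst.
  apply: cvg_near_cst; near=> n.
  have n0 : 0 < n.+1%:R^-1 :> R by rewrite invr_gt0 ltr0n.
  rewrite mulNr -mulrBr. rewrite sg_sin; first by rewrite sgrM gtr0_sg// mul1r.
  rewrite normrM gtr0_norm// mulrC ltr_pdivrMr//.
  have h : `|x w - c| < n%:R by near: n; exact: nbhs_infty_gtr.
  apply: (lt_le_trans h); apply: (@le_trans _ _ n.+1%:R); first by rewrite ler_nat.
  by rewrite ler_peMl//; apply: le_trans (pi_ge2 _); lra.
- exact: L1_norm.
- move=> n w; rewrite normrM ler_piMr//.
  by rewrite normr_sg; case: (_ == 0).
- by move=> n; exact: Rintegral_sg_sin.
Unshelve. all: end_near. Qed.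

(** The sign is 0 at its jump, so the jump is placed at c + 1 / (n + 1): the signs then tend to 2
    1_{]c, oo[} - 1 everywhere, x = c included. *)
Lemma Rintegral_ray c : \int[mu]_w (D w * \1_`]c, +oo[ (x w)) = 0.
Proof.
have mI : measurable_fun [set: T] (fun w => \1_`]c, +oo[ (x w) : R).
  by apply: measurableT_comp => //; exact: measurable_indic.
have LI : L1 (fun w => D w * \1_`]c, +oo[ (x w)).
  apply: (L1_bounded D_L1 mI (C := 1)) => w; rewrite indicE.
  by rewrite ger0_norm// lern1 leq_b1.
suff : \int[mu]_w (D w * (2 * \1_`]c, +oo[ (x w) - 1)) = 0.
  under eq_Rintegral do rewrite mulrBr mulr1 mulrCA.
  rewrite RintegralB//; last exact: L1Z.
  rewrite D_mean subr0 RintegralZl// => /eqP.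
  by rewrite mulf_eq0 pnatr_eq0 /= => /eqP.
apply: (@Rintegral_eq0_limit _ _ _ mu
    (fun n w => D w * Num.sg (x w - (c + n.+1%:R^-1))) _ (fun w => `|D w|)).
- move=> n; apply: measurable_funM; first exact: L1_measurable D_L1.
  by apply: measurableT_comp; [exact: measurable_sg|exact: measurable_funB].
- move=> w; apply: cvgM; first exact: cvg_cst.
  apply: cvg_near_cst; rewrite indicE mem_setE in_itv /= andbT.
  have [cx|xc] := ltP c (x w).
    near=> n.
    rewrite gtr0_sg ?mulr1n; first by ring.
    rewrite subr_gt0 -ltrBrDl; near: n.
    by apply: near_infty_natSinv_lt (PosNum _); rewrite subr_gt0.
  near=> n; rewrite ltr0_sg ?mulr0n; first by ring.
  by rewrite subr_lt0 (le_lt_trans xc)// ltrDl invr_gt0.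
- exact: L1_norm.
- move=> n w; rewrite normrM ler_piMr//.
  by rewrite normr_sg; case: (_ == 0).
- by move=> n; exact: Rintegral_sg.
Unshelve. all: end_near. Qed.

End one_variable.

Lemma L1_indic f A : L1 f -> measurable A -> L1 (fun w => f w * \1_A w).
Proof.
move=> fi mA; apply: (L1_bounded fi (C := 1)); first exact: measurable_indic.
by move=> w; rewrite indicE ger0_norm// lern1 leq_b1.
Qed.

(** Dynkin's argument, applied directly to the signed set function A |-> E[D 1_A]. *)
Lemma Rintegral_pi_lambda (G : set (set T)) D :
  setI_closed G -> G `<=` measurable -> L1 D -> \int[mu]_w D w = 0 ->
  (forall A, G A -> \int[mu]_w (D w * \1_A w) = 0) ->
  forall A, <<s G >> A -> \int[mu]_w (D w * \1_A w) = 0.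
Proof.
move=> GI Gm DL D0 GD A GA.
suff /(_ A GA) [] : <<s G >> `<=`
    [set A | measurable A /\ \int[mu]_w (D w * \1_A w) = 0] by [].
apply: lambda_system_subset => //; last first.
  by move=> B GB; split; [exact: Gm|exact: GD].
split => //.
- by split => //; under eq_Rintegral do rewrite indicE in_setT mulr1.
- move=> B C CB [mB B0] [mC C0]; split; first exact: measurableD.
  transitivity (\int[mu]_w (D w * \1_B w - D w * \1_C w)).
    apply: eq_Rintegral => w _; rewrite -mulrBr; congr (_ * _); rewrite !indicE in_setD.
    have [wC|wC] := boolP (w \in C).
      by rewrite (mem_set (CB _ (set_mem wC))) /= subrr.
    by rewrite andbT subr0.
  by rewrite RintegralB ?B0 ?C0 ?subrr//; exact: L1_indic.
- move=> F Fnd FH.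
  have mF n : measurable (F n) by have [] := FH n.
  split; first exact: bigcupT_measurable.
  apply: (@Rintegral_eq0_limit _ _ _ mu (fun n w => D w * \1_(F n) w) _ (fun w => `|D w|)).
  + by move=> n; exact/L1_measurable/L1_indic.
  + move=> w; apply: cvgM; first exact: cvg_cst.
    rewrite indicE; have [/set_mem[N _ FNw]|wF] := boolP (w \in \bigcup_i F i).
      apply: cvg_near_cst; exists N => // n /= Nn; rewrite indicE mem_set//.
      by move/subsetPset: (Fnd _ _ Nn); apply.
    apply: cvg_near_cst; apply: nearW => n; rewrite indicE memNset// => Fnw.
    by move/negP: wF; apply; apply/mem_set; exists n.
  + exact: L1_norm.
  + move=> n w; rewrite normrM ler_piMr// indicE ger0_norm//.
    by rewrite lern1 leq_b1.
  + by move=> n; have [] := FH n.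
Qed.

Lemma Rintegral_borel D x B : L1 D -> measurable_fun [set: T] x ->
  (forall a b, \int[mu]_w (D w * cos (a * x w + b)) = 0) ->
  measurable B -> \int[mu]_w (D w * \1_B (x w)) = 0.
Proof.
move=> DL mx Dcos mB.
pose G := preimage_set_system [set: T] x (@RGenOInfty.G R).
have GB : <<s G >> (x @^-1` B).
  rewrite g_sigma_preimageE; exists B; last by rewrite setTI.
  by rewrite -RGenOInfty.measurableE.
apply: (Rintegral_pi_lambda _ _ DL _ _ GB).
- move=> _ _ [_ [a ->] <-] [_ [b ->] <-]; exists (`]Num.max a b, +oo[%classic).
    by exists (Num.max a b).
  apply/seteqP; split=> w /=; rewrite !in_itv /= !andbT gt_max; first by move=> [_ /andP[]].
  by move=> [[_ ->] [_ ->]].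
- by move=> _ [_ [a ->] <-]; apply: mx => //.
- rewrite -(Dcos 0 0); apply: eq_Rintegral => w _.
  by rewrite mul0r addr0 cos0 mulr1.
- move=> _ [_ [a ->] <-]; rewrite -[RHS](Rintegral_ray DL mx Dcos a).
  by apply: eq_Rintegral => w _; rewrite setTI.
Qed.

Section family.
Context (I : Type) (x : I -> T -> R) (x_meas : forall i, measurable_fun [set: T] (x i)).

(** Finite intersections of preimages, in a list-like form that lets an induction absorb one
    constraint at a time. *)
Inductive cylinder : set T -> Prop :=
| cylinderT : cylinder [set: T]
| cylinderI i (B : set R) C : measurable B -> cylinder C -> cylinder (x i @^-1` B `&` C).

Lemma cylinder_setI : setI_closed cylinder.
Proof.
move=> A B cA cB; elim: cA => [|i E C mE _ IH]; first by rewrite setTI.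
by rewrite -setIA; exact: cylinderI.
Qed.

Lemma cylinder_measurable : cylinder `<=` measurable.
Proof.
move=> A; elim=> [|i E C mE _ IH]; first exact: measurableT.
by apply: measurableI => //; rewrite -[_ @^-1` _]setTI; exact: x_meas.
Qed.

Lemma measurable_comb (s : seq (R * I)) :
  measurable_fun [set: T] (fun w => \sum_(p <- s) p.1 * x p.2 w).
Proof. by apply: measurable_sum => p; exact: measurable_funM. Qed.

(** The induction on the cylinder replaces D by D 1_B(x_i). This product again has vanishing
    transform, by the one-variable result for D cos (sum + b) and x_i; hence D is generalized. *)
Lemma fourier_uniqueness D : L1 D ->
  (forall (s : seq (R * I)) b,
    \int[mu]_w (D w * cos (\sum_(p <- s) p.1 * x p.2 w + b)) = 0) ->
  forall A, <<s cylinder >> A -> \int[mu]_(w in A) D w = 0.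
Proof.
move=> DL Dcos A cA; rewrite Rintegral_indic.
apply: (Rintegral_pi_lambda cylinder_setI cylinder_measurable DL _ _ cA).
  by rewrite -(Dcos [::] 0); apply: eq_Rintegral => w _; rewrite big_nil addr0 cos0 mulr1.
move=> {cA A} A cA; elim: cA D DL Dcos => [|i B C mB cC IH] D DL Dcos.
  rewrite -(Dcos [::] 0); apply: eq_Rintegral => w _.
  by rewrite big_nil addr0 cos0 indicE in_setT.
have mxB : measurable (x i @^-1` B) by rewrite -[_ @^-1` _]setTI; exact: x_meas.
rewrite -[RHS](IH (fun w => D w * \1_(x i @^-1` B) w)).
- by apply: eq_Rintegral => w _; rewrite indicI /= mulrA.
- exact: L1_indic.
move=> s b.
under eq_Rintegral do rewrite mulrAC.
have mc s' b' : measurable_fun [set: T] (fun w => \sum_(p <- s') p.1 * x p.2 w + b').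
  by apply: measurable_funD => //; exact: measurable_comb.
apply: (@Rintegral_borel (fun w => D w * cos (\sum_(p <- s) p.1 * x p.2 w + b)) (x i)) => //.
  exact: L1_cos.
move=> a b'.
pose u w := \sum_(p <- s) p.1 * x p.2 w.
(* The product of the two cosines has the frequencies of a x_i + u and a x_i - u; [s'] provides the
   second. *)
pose s' := [seq (- p.1, p.2) | p <- s].
have E (w : T) : \sum_(p <- s') p.1 * x p.2 w = - u w.
  by rewrite big_map /u -sumrN; apply: eq_bigr => p _; rewrite mulNr.
transitivity (\int[mu]_w (2^-1 * (D w * cos (\sum_(p <- (a, i) :: s) p.1 * x p.2 w + (b' + b))) +
    2^-1 * (D w * cos (\sum_(p <- (a, i) :: s') p.1 * x p.2 w + (b' - b))))).
  apply: eq_Rintegral => w _; rewrite !big_cons E -/(u w) /=.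
  rewrite -mulrA [cos _ * _]mulrC cos_mul_cos mulrDr !(mulrCA (D w)).
  by congr (_ * (_ * cos _) + _ * (_ * cos _)); ring.
rewrite RintegralD//; [|exact/L1Z/L1_cos..].
by rewrite !RintegralZl ?Dcos ?mulr0 ?addr0//; exact: L1_cos.
Qed.

End family.
End fourier_uniqueness.

(** * Gaussian variables *)

Section hermite.
Context {R : realType}.

(* The recursion follows that of [wick_pair]; [c] is the variance of the argument. *)
Fixpoint hermite_pair (c t : R) n : R * R :=
  if n is m.+1 then
    let w := hermite_pair c t m in (w.2, t * w.2 - m.+1%:R * (c * w.1))
  else (1, t).

(** For c > 0 this is c^(n/2) He_n(t / sqrt c), with He_n the monic Hermite polynomials of the
    standard normal law; for c = 0 it is t^n. *)
Definition hermite c t n : R := (hermite_pair c t n).1.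

Lemma hermite0 c t : hermite c t 0 = 1. Proof. by []. Qed.

Lemma hermite1 c t : hermite c t 1 = t. Proof. by []. Qed.

Lemma hermiteSS c t n : hermite c t n.+2 =
  t * hermite c t n.+1 - n.+1%:R * (c * hermite c t n).
Proof. by []. Qed.

End hermite.

Section gaussian_variables.
Context {R : realType} d {T : measurableType d} (mu : probability T R).
Implicit Types (f g h x y : T -> R).

Local Notation L1 f := (mu.-integrable [set: T] (EFin \o f)).

Lemma L1_of_Fatou (f_ : nat -> T -> R) f (K : R) :
  (forall n, L1 (f_ n)) -> (forall n w, 0 <= f_ n w) ->
  (forall w, f_ n w @[n --> \oo] --> f w) ->
  (forall n, \int[mu]_w f_ n w <= K) -> L1 f.
Proof.
move=> fi f0 ff fK.
have mf : measurable_fun [set: T] f.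
  by apply: (measurable_fun_cvg (h := f_)) => [n|w _]; [exact: L1_measurable|exact: ff].
have f_ge0 w : 0 <= f w.
  rewrite -(cvg_lim _ (ff w))//; apply: limr_ge; last exact: nearW.
  by apply/cvg_ex; exists (f w); exact: ff.
apply/integrableP; split; first exact/measurable_EFinP.
apply: (@le_lt_trans _ _ K%:E); last exact: ltry.
rewrite (_ : (fun w => _) = fun w => limn_einf (fun n => (f_ n w)%:E)); last first.
  apply/funext => w; rewrite /= ger0_norm//.
  have /cvg_limn_einf_sup[-> _//] : (f_ n w)%:E @[n --> \oo] --> (f w)%:E.
  by apply: cvg_EFin; [exact: nearW|exact: ff].
apply: le_trans (fatou mu measurableT _ _) _.
- by move=> n; exact/measurable_EFinP/L1_measurable.
- by move=> n w _; rewrite lee_fin.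
rewrite limn_einf_lim; apply: lime_le; first exact: is_cvg_einfs.
apply: nearW => n; apply: (@le_trans _ _ (\int[mu]_w (f_ n w)%:E)%E).
  by apply: ereal_inf_lbound; exists n => //=.
rewrite -(fineK (integrable_fin_num measurableT (fi n))) lee_fin; exact: fK.
Qed.

Lemma is_derive_cvg_seq (q : R -> R) (q' : R) : is_derive (0 : R) 1 q q' ->
  n.+1%:R * (q n.+1%:R^-1 - q 0) @[n --> \oo] --> q'.
Proof.
case=> dq <-.
have /cvgr_dnbhsP /(_ (fun n => n.+1%:R^-1)) h :
    (fun h : R => h^-1 * (q (h * 1 + 0) - q 0)) @ (0 : R)^' --> ('D_1 q (0 : R) : R).
  exact: dq.
have {h} : (n.+1%:R^-1)^-1 * (q (n.+1%:R^-1 * 1 + 0) - q 0) @[n --> \oo] --> ('D_1 q (0 : R) : R).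
  apply: h; split=> [n|]; first by rewrite invr_eq0 pnatr_eq0.
  exact: cvg_harmonic.
by under eq_fun do rewrite invrK addr0 mulr1.
Qed.

Lemma is_derive_affine (a b t : R) : is_derive t (1 : R) (fun s : R => s * a + b) a.
Proof.
rewrite (_ : (fun s => _) = (id : R -> R) * cst a + cst b); last exact/funext.
by apply: is_derive_eq; rewrite /= scaler0 add0r addr0 [_ *: _]mulr1.
Qed.

Lemma cvg_sin_scaled (r : R) : n.+1%:R * sin (n.+1%:R^-1 * r) @[n --> \oo] --> r.
Proof.
have d1 := is_derive_affine r 0 0.
have d2 : is_derive (0 : R) 1 (fun s : R => sin (s * r + 0)) r.
  have := is_derive1_comp (is_derive_sin _) d1.
  by rewrite mul0r addr0 cos0 mul1r.
have := is_derive_cvg_seq d2.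
by under eq_fun do rewrite mul0r !addr0 sin0 subr0.
Qed.

(* Fatou's lemma for 2 (1 - cos (s x)) / s^2, which tends to x^2 as s tends to 0. *)
Lemma L1_mul_sqr W x (K : R) : L1 W -> (forall w, 0 <= W w) ->
  measurable_fun [set: T] x ->
  (forall s, 0 < s <= 1 -> \int[mu]_w (W w * (1 - cos (s * x w))) <= K * s ^+ 2) ->
  L1 (fun w => W w * x w ^+ 2).
Proof.
move=> WL W0 mx WK.
have s_gt0 n : 0 < n.+1%:R^-1 :> R by rewrite invr_gt0 ltr0n.
have s_le1 n : n.+1%:R^-1 <= 1 :> R by rewrite invf_le1 ?ler1n ?ltr0n.
have LW n : L1 (fun w => W w * (1 - cos (n.+1%:R^-1 * x w))).
  have := L1B WL (L1_cos WL (measurable_affine n.+1%:R^-1 0 mx)).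
  by under eq_fun do rewrite addr0 -{1}[W _]mulr1 -mulrBr.
have cos_le1 (r : R) : 0 <= 1 - cos r by rewrite subr_ge0 cos_le1.
suff L : L1 (fun w => 2^-1 * (W w * x w ^+ 2)).
  have := L1Z 2 L; by under eq_fun do rewrite mulrA divff ?pnatr_eq0// mul1r.
apply: (@L1_of_Fatou (fun n w => n.+1%:R ^+ 2 * (W w * (1 - cos (n.+1%:R^-1 * x w)))) _ K).
- by move=> n; exact: L1Z.
- by move=> n w; rewrite mulr_ge0 ?sqr_ge0// mulr_ge0.
- move=> w.
  have E n : n.+1%:R ^+ 2 * (W w * (1 - cos (n.+1%:R^-1 * x w))) =
     W w * (2 * (n.+1%:R * sin (n.+1%:R^-1 * (x w / 2))) ^+ 2).
    have -> : n.+1%:R^-1 * x w = (n.+1%:R^-1 * (x w / 2)) *+ 2 by rewrite -mulr_natr; field.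
    set u := _ * (x w / 2); rewrite mulr2n cosD -!expr2 cos2sin2; ring.
  under eq_fun do rewrite E.
  rewrite (_ : 2^-1 * _ = W w * (2 * (x w / 2) ^+ 2)); last by field.
  apply: cvgMr; apply: cvgMr.
  rewrite expr2; under eq_fun do rewrite expr2.
  by apply: cvgM; exact: cvg_sin_scaled.
- move=> n; rewrite RintegralZl//.
  have := WK n.+1%:R^-1; rewrite s_gt0 s_le1 => /(_ isT) h.
  rewrite -ler_pdivlMl; last by rewrite exprn_gt0.
  by rewrite -exprVn mulrC.
Qed.

(** Differentiation at s = 0 under the integral sign, dominated by |W x|. The derivative of the
    cosine is written as its shift by pi / 2, so that the result is again an integral against a
    cosine with a phase. *)
Lemma Rintegral_derive_cos W x y (q : R -> R) (q' : R) b :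
  L1 W -> L1 (fun w => W w * x w) ->
  measurable_fun [set: T] x -> measurable_fun [set: T] y ->
  (forall s, \int[mu]_w (W w * cos (s * x w + y w + b)) = q s) ->
  is_derive (0 : R) 1 q q' ->
  \int[mu]_w (W w * x w * cos (y w + b + pi / 2)) = q'.
Proof.
move=> WL WxL mx my Eq dq.
pose F (s : R) w := W w * cos (s * x w + (y w + b)).
have dF (s : R) w : is_derive s (1 : R) (F^~ w) (W w * (- sin (s * x w + (y w + b)) * x w)).
  have d1 := is_derive1_comp (is_derive_cos _) (is_derive_affine (x w) (y w + b) s).
  rewrite (_ : F^~ w = W w \*: (cos \o (fun s => s * x w + (y w + b)))); last exact/funext.
  exact: is_deriveZ.
have dF1 s w : partial1of2 F s w = W w * (- sin (s * x w + (y w + b)) * x w).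
  by rewrite partial1of2E; exact: (@derive_val _ _ _ _ _ _ _ (dF s w)).
have FL s : L1 (F s).
  apply: L1_cos => //; apply: measurable_funD; first exact: measurable_funM.
  exact: measurable_funD.
have Fq : (fun s => \int[mu]_w F s w) = q.
  apply/funext => s; rewrite -Eq; apply: eq_Rintegral => w _.
  by rewrite /F addrA.
(* The bound holds for every s, so any interval around 0 would do; it is ]-1, 1[. *)
have := @differentiation_under_integral _ _ _ mu F _ measurableT 0 (-1) 1 _ _ _
   (fun w => `|W w * x w|) _ (L1_norm WxL) _.
rewrite Fq derive1E (@derive_val _ _ _ _ _ _ _ dq) => ->.
- apply: eq_Rintegral => w _.
  by rewrite dF1 cosDpihalf mul0r add0r; ring.
- by rewrite /= in_itv /= ltrN10 ltr01.
- by [].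
- by move=> s w _ _; have [] := dF s w.
- by [].
- move=> s w _ _; rewrite dF1 mulrCA mulNr normrN mulrC normrM ler_piMr//.
  exact: sin_max.
Qed.

(* [x] and [y] are centered and jointly Gaussian with variances [c], [e] and
   covariance [b]; the phase [t] combines the real and imaginary parts of the
   characteristic function. *)
Definition gaussian_pair x (c : R) y (b e : R) := forall s t,
  \int[mu]_w cos (s * x w + y w + t) =
  cos t * expR (- 2^-1 * (c * s ^+ 2 + 2 * b * s + e)).

(** Adding multiples of x to y stays within Gaussian pairs; this yields the functions of s that are
    differentiated at 0. *)
Lemma gaussian_pair_shift x c y b e s0 : gaussian_pair x c y b e ->
  gaussian_pair x c (fun w => s0 * x w + y w) (c * s0 + b)
    (c * s0 ^+ 2 + 2 * b * s0 + e).
Proof.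
move=> g s t; rewrite -[RHS](_ : cos t * expR
    (- 2^-1 * (c * (s + s0) ^+ 2 + 2 * b * (s + s0) + e)) = _); last first.
  by congr (_ * expR (_ * _)); ring.
by rewrite -g; apply: eq_Rintegral => w _; congr cos; ring.
Qed.

(** [hermite] has degree j in x. The moments are assumed only up to N because the higher ones are
    still to be proved when this is applied. *)
Lemma L1_pow_hermite x c N : (forall i, (i <= N)%N -> L1 (fun w => x w ^+ i)) ->
  forall j m, (m + j <= N)%N -> L1 (fun w => x w ^+ m * hermite c (x w) j).
Proof.
move=> xL j.
suff [] : (forall m, (m + j <= N)%N -> L1 (fun w => x w ^+ m * hermite c (x w) j)) /\
    (forall m, (m + j.+1 <= N)%N -> L1 (fun w => x w ^+ m * hermite c (x w) j.+1)) by [].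
elim: j => [|j [IH0 IH1]]; split=> // m mN.
- by under eq_fun do rewrite hermite0 mulr1; apply: xL; rewrite -[m]addn0.
- by under eq_fun do rewrite hermite1 -exprSr; apply: xL; rewrite -addn1.
have E w : x w ^+ m * hermite c (x w) j.+2 =
    x w ^+ m.+1 * hermite c (x w) j.+1 -
    (j.+1%:R * c) * (x w ^+ m * hermite c (x w) j).
  by rewrite hermiteSS exprS; ring.
under eq_fun do rewrite E.
apply: L1B; first by apply: IH1; rewrite addSnnS.
by apply/L1Z/IH0; apply: leq_trans mN; rewrite leq_add2l; do 2 apply: leqW.
Qed.

(** The function is the transform of order n at s x + y: c s + b is the covariance of x with s x +
    y, and the bracket in the exponent is the variance of s x + y. For n = 0 the value of [n.-1] is
    irrelevant, its term having the factor 0. *)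
Lemma is_derive_gaussian (k c b e : R) n :
  is_derive (0 : R) (1 : R)
    (fun s : R => k * (c * s + b) ^+ n * expR (- 2^-1 * (c * s ^+ 2 + 2 * b * s + e)))
    (k * (n%:R * c * b ^+ n.-1 - b ^+ n.+1) * expR (- 2^-1 * e)).
Proof.
have d1 : is_derive (0 : R) (1 : R) (fun s : R => s * c + b) c := is_derive_affine c b 0.
have d2 := is_deriveX n d1.
have d3 := is_deriveM (is_derive_id (0 : R) (1 : R)) (is_derive_affine c (2 * b) 0).
have d4 := is_deriveZ (- 2^-1) (is_deriveD d3 (is_derive_cst e (0 : R) (1 : R))).
have d5 := is_derive1_comp (is_derive_expR _) d4.
have d6 := is_deriveZ k (is_deriveM d2 d5).
have scaleE (r t : R) : r *: t = r * t by [].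
move: (is_derive_eq d6 (erefl _)); set q := (X in is_derive _ _ X _) => dq.
rewrite (_ : (fun s => _) = q); last first.
  apply/funext => s; rewrite /q /= !fctE /= -mulrA (mulrC c s) scaleE.
  by congr (_ * (_ * expR (_ * _))); ring.
apply: (is_derive_eq dq).
rewrite !fctE /= !scaleE !mul0r !add0r !addr0 mulr1 exprS.
by move: (b ^+ n) (b ^+ n.-1) (expR _) => p p' ex; field.
Qed.

Section hermite_transform.
Variables (x : T -> R) (c : R) (N : nat).
Hypothesis x_meas : measurable_fun [set: T] x.
Hypothesis x_moments : forall i, (i <= N)%N -> L1 (fun w => x w ^+ i).

Let transform n := forall y b e t, measurable_fun [set: T] y ->
  gaussian_pair x c y b e ->
  \int[mu]_w (hermite c (x w) n * cos (y w + t)) =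
  cos (t + n%:R * (pi / 2)) * b ^+ n * expR (- 2^-1 * e).

Let hermite_L1 n : (n <= N)%N -> L1 (fun w => hermite c (x w) n).
Proof.
move=> nN; have := L1_pow_hermite c x_moments (m := 0) nN.
by under eq_fun do rewrite expr0 mul1r.
Qed.

Let hermite_mul_L1 n : (n < N)%N -> L1 (fun w => hermite c (x w) n * x w).
Proof.
move=> nN; have := L1_pow_hermite c x_moments (m := 1) nN.
by under eq_fun do rewrite expr1 mulrC.
Qed.

(** Gaussian integration by parts: a factor x is produced by the derivative in s of the transform at
    s x + y. The phase t - pi / 2 cancels the shift that comes with this derivative. *)
Let transform_mul n : (n < N)%N -> transform n ->
  forall y b e t, measurable_fun [set: T] y -> gaussian_pair x c y b e ->
  \int[mu]_w (hermite c (x w) n * x w * cos (y w + t)) =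
  cos (t - pi / 2 + n%:R * (pi / 2)) * (n%:R * c * b ^+ n.-1 - b ^+ n.+1) * expR (- 2^-1 * e).
Proof.
move=> nN Tn y b e t my g.
rewrite -(Rintegral_derive_cos (b := t - pi / 2) (hermite_L1 (ltnW nN))
  (hermite_mul_L1 nN) x_meas my _
  (is_derive_gaussian _ _ _ _ _)).
  by apply: eq_Rintegral => w _; congr (_ * cos _); ring.
move=> s; apply: Tn (gaussian_pair_shift s g).
by apply: measurable_funD => //; exact: measurable_funM.
Qed.

(* This is E[h_n(x) exp (i y)] = i^n b^n exp (- e / 2). *)
Lemma hermite_transform n y b e t : (n <= N)%N -> measurable_fun [set: T] y ->
  gaussian_pair x c y b e ->
  \int[mu]_w (hermite c (x w) n * cos (y w + t)) =
  cos (t + n%:R * (pi / 2)) * b ^+ n * expR (- 2^-1 * e).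
Proof.
move=> nN; move: y b e t.
(* The recursion has three terms, so two consecutive orders are carried along. *)
suff [] : ((n <= N)%N -> transform n) /\ ((n < N)%N -> transform n.+1) by move=> + _; exact.
elim: {nN} n => [|n [IH0 IH1]].
  have T0 : transform 0.
    move=> y b e t my g; rewrite mul0r addr0 expr0 mulr1.
    have := g 0 t; rewrite expr0n mulr0 mulr0 !add0r => <-.
    by apply: eq_Rintegral => w _; rewrite hermite0 mul1r mul0r add0r.
  split=> // N0 y b e t my g.
  transitivity (\int[mu]_w (hermite c (x w) 0 * x w * cos (y w + t))).
    by apply: eq_Rintegral => w _; rewrite hermite0 hermite1 mul1r.
  rewrite (transform_mul N0 T0 t my g) !mul0r sub0r addr0 mul1r expr1 mulrN cosBpihalf cosDpihalf.
  by rewrite -mulNr.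
split=> // nN y b e t my g.
have LL j : (j <= N)%N -> L1 (fun w => hermite c (x w) j * cos (y w + t)).
  by move=> jN; apply: L1_cos; [exact: hermite_L1|exact: measurable_funD].
transitivity (\int[mu]_w (hermite c (x w) n.+1 * x w * cos (y w + t) -
    (n.+1%:R * c) * (hermite c (x w) n * cos (y w + t)))).
  by apply: eq_Rintegral => w _; rewrite hermiteSS; ring.
have nN1 : (n < N)%N by exact: ltnW.
have nN0 : (n <= N)%N by exact: ltnW.
rewrite RintegralB//; last 2 first.
- by apply: L1_cos; [exact: hermite_mul_L1|exact: measurable_funD].
- exact/L1Z/LL.
rewrite RintegralZl//; last exact: LL.
(* The terms with c b^n cancel; the sign of the remaining b^(n+2) is a phase shift by pi. *)
rewrite (transform_mul nN (IH1 nN1) t my g) (IH0 nN0 _ _ _ _ my g) /=.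
have -> : t - pi / 2 + n.+1%:R * (pi / 2) = t + n%:R * (pi / 2) by rewrite -natr1; ring.
have -> : t + n.+2%:R * (pi / 2) = t + n%:R * (pi / 2) + pi by rewrite -!natr1; field.
by rewrite cosDpi !exprS; ring.
Qed.

(** The transform is used at y = 0 and y = s x, with covariances 0 and c s. For n = 0 the difference
    is 1 - exp (- c s^2 / 2), bounded by c s^2; for n = 1 the phase gives 0; for n >= 2 the power (c
    s)^n is at most c^n s^2. The constant covers all three cases. *)
Lemma hermite_transform_sub n s : (n <= N)%N -> 0 <= c -> 0 < s <= 1 ->
  gaussian_pair x c (cst 0) 0 0 ->
  `|\int[mu]_w (hermite c (x w) n * (1 - cos (s * x w)))| <= (c + c ^+ n) * s ^+ 2.
Proof.
move=> nN c0 /andP[s0 s1] g.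
have gs := gaussian_pair_shift s g.
have m0 : measurable_fun [set: T] (cst (0 : R)) by exact: measurable_cst.
have E0 := hermite_transform 0 nN m0 g.
have Es := hermite_transform 0 nN (measurable_affine s 0 x_meas) gs.
have -> : \int[mu]_w (hermite c (x w) n * (1 - cos (s * x w))) =
   \int[mu]_w (hermite c (x w) n * cos (cst 0 w + 0)) -
   \int[mu]_w (hermite c (x w) n * cos (s * x w + 0 + 0)).
  rewrite -RintegralB//; last 2 first.
  - by apply: L1_cos; [exact: hermite_L1|exact: measurable_funD].
  - by apply: L1_cos; [exact: hermite_L1|apply: measurable_funD => //; exact: measurable_affine].
  by apply: eq_Rintegral => w _; rewrite mulrBr /= !addr0 cos0.
rewrite E0 Es !add0r !mulr0 !mul0r !addr0 expR0 mulr1.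
have cs : 0 <= c * s ^+ 2 by rewrite mulr_ge0 ?sqr_ge0.
have e1 : expR (- 2^-1 * (c * s ^+ 2)) <= 1.
  by rewrite -[leRHS]expR0 ler_expR; lra.
have e2 := expR_ge1Dx (- 2^-1 * (c * s ^+ 2)).
have e0 := expR_ge0 (- 2^-1 * (c * s ^+ 2)).
case: n {nN E0 Es} => [|[|n]].
- rewrite mul0r !expr0 cos0 !mul1r ger0_norm ?subr_ge0//.
  by have := sqr_ge0 s; lra.
- by rewrite mul1r cos_pihalf !mul0r subrr normr0 mulr_ge0 ?sqr_ge0// addr_ge0// exprn_ge0.
rewrite [0 ^+ _]expr0n mulr0 sub0r normrN.
have pow_bound : (c * s) ^+ n.+2 <= (c + c ^+ n.+2) * s ^+ 2.
  rewrite exprMn mulrDl -[leLHS]add0r lerD// ler_wpM2l ?exprn_ge0//.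
  by rewrite -addn2 exprD ler_piMl ?sqr_ge0// exprn_ile1// ltW.
have : 0 <= (c * s) ^+ n.+2 by rewrite exprn_ge0// mulr_ge0// ltW.
move: ((c * s) ^+ n.+2) pow_bound => p pow_bound p0.
apply: le_trans pow_bound; rewrite !normrM (ger0_norm e0) (ger0_norm p0).
apply: (@le_trans _ _ (p * expR (- 2^-1 * (c * s ^+ 2)))); last by rewrite ler_piMr.
by rewrite -mulrA ler_piMl ?cos_max// mulr_ge0.
Qed.

(** The recursion read as x h_(n+1) = h_(n+2) + (n+1) c h_n trades each power of x for Hermite
    polynomials of neighbouring orders. *)
Lemma pow_hermite_transform_sub m : 0 <= c -> gaussian_pair x c (cst 0) 0 0 ->
  forall n, (m + n <= N)%N -> exists K, forall s, 0 < s <= 1 ->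
  `|\int[mu]_w (x w ^+ m * hermite c (x w) n * (1 - cos (s * x w)))| <= K * s ^+ 2.
Proof.
move=> c0 g; elim: m => [|m IHm] n mN.
  exists (c + c ^+ n) => s s01.
  by under eq_Rintegral do rewrite expr0 mul1r; exact: hermite_transform_sub.
have LL i j s : (i + j <= N)%N ->
    L1 (fun w => x w ^+ i * hermite c (x w) j * (1 - cos (s * x w))).
  move=> ijN; have L := L1_pow_hermite c x_moments ijN.
  have := L1B L (L1_cos L (measurable_affine s 0 x_meas)).
  by under eq_fun do rewrite addr0 -{1}[_ * hermite _ _ _]mulr1 -mulrBr.
have mN1 : (m + n.+1 <= N)%N by rewrite -addSnnS.
have [K1 HK1] := IHm n.+1 mN1.
case: n mN mN1 HK1 => [|n] mN mN1 HK1.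
  exists K1 => s s01.
  apply: le_trans (HK1 s s01); rewrite le_eqVlt; apply/orP; left; apply/eqP; congr (`|_|).
  by apply: eq_Rintegral => w _; rewrite hermite0 hermite1 exprSr mulr1.
have mN2 : (m + n <= N)%N by apply: leq_trans mN; rewrite addSnnS leq_add2l; do 2 apply: leqW.
have [K2 HK2] := IHm n mN2.
exists (K1 + `|n.+1%:R * c| * K2) => s s01.
have -> : \int[mu]_w (x w ^+ m.+1 * hermite c (x w) n.+1 * (1 - cos (s * x w))) =
    \int[mu]_w (x w ^+ m * hermite c (x w) n.+2 * (1 - cos (s * x w))) +
    (n.+1%:R * c) * \int[mu]_w (x w ^+ m * hermite c (x w) n * (1 - cos (s * x w))).
  rewrite -RintegralZl//; last exact: LL.
  rewrite -RintegralD//; [|by apply: LL; rewrite -addSnnS|exact/L1Z/LL].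
  by apply: eq_Rintegral => w _; rewrite hermiteSS exprS; ring.
apply: le_trans (ler_normD _ _) _; rewrite normrM mulrDl lerD//; first exact: HK1.
by rewrite -mulrA ler_wpM2l//; exact: HK2.
Qed.

End hermite_transform.

(* If x^(2k) is integrable, then hermite_transform holds up to order 2k and bounds
   E[x^(2k) (1 - cos (s x))] by a multiple of s^2, so that x^(2k+2) is integrable. *)
Lemma gaussian_moments x c : measurable_fun [set: T] x -> 0 <= c ->
  gaussian_pair x c (cst 0) 0 0 -> forall i, L1 (fun w => x w ^+ i).
Proof.
move=> mx c0 g.
have low k : L1 (fun w => x w ^+ (2 * k)) ->
    forall i, (i <= 2 * k)%N -> L1 (fun w => x w ^+ i).
  move=> L i ik; apply: (L1_le _ (L1D (L1_cst mu 1) L)).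
    exact: measurable_funX.
  move=> w; rewrite [leRHS]ger0_norm; last by rewrite addr_ge0// exprM exprn_ge0// sqr_ge0.
  have E : x w ^+ (2 * k) = `|x w| ^+ (2 * k).
    by rewrite !exprM real_normK ?num_real.
  rewrite normrX E /=; have [x1|x1] := leP `|x w| 1.
    by apply: (@le_trans _ _ 1); [exact: exprn_ile1|rewrite lerDl exprn_ge0].
  by apply: (@le_trans _ _ (`|x w| ^+ (2 * k))); [rewrite ler_eXn2l|rewrite lerDr].
have even k : L1 (fun w => x w ^+ (2 * k)).
  elim: k => [|k IHk]; first by under eq_fun do rewrite muln0 expr0; exact: L1_cst.
  have le2k : (2 * k + 0 <= 2 * k)%N by rewrite addn0.
  have [K HK] := pow_hermite_transform_sub mx (low k IHk) c0 g le2k.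
  under eq_fun do rewrite mulnS addnC exprD.
  apply: (L1_mul_sqr IHk (K := K)) => //.
    by move=> w; rewrite exprM exprn_ge0// sqr_ge0.
  move=> s s01; apply: le_trans (ler_norm _) _.
  apply: le_trans (HK s s01); rewrite le_eqVlt; apply/orP; left; apply/eqP; congr (`|_|).
  by apply: eq_Rintegral => w _; rewrite hermite0 mulr1.
by move=> i; apply: (low i (even i)); rewrite leq_pmull.
Qed.

End gaussian_variables.

(** * Wick powers *)

Section symmetric_forms.
Context {R : realType} (V : lmodType R).

Definition msymmetric n (F : multiform V n) := forall s : 'S_n, mperm s F = F.

Lemma multiform_eq n (F F' : multiform V n) : (forall v, F v = F' v) -> F = F'.
Proof. by move=> FF'; apply/val_inj/funext. Qed.

Lemma multiform_sumE n (I : Type) (r : seq I) (F : I -> multiform V n) v :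
  (\sum_(i <- r) F i) v = \sum_(i <- r) (F i v : R) :> R.
Proof.
by elim: r => [|i r IHr]; rewrite ?big_nil// !big_cons -IHr.
Qed.

Lemma msymmE n (F : multiform V n) v :
  msymm F v = n`!%:R^-1 * \sum_(s : 'S_n) (F (v \o s) : R) :> R.
Proof. by rewrite -(multiform_sumE _ (fun s => mperm s F)). Qed.

Lemma fact_mulVn n (r : R) : n`!%:R^-1 * (r *+ n`!) = r.
Proof. by rewrite -[X in _ * X]mulr_natl mulKf// pnatr_eq0 -lt0n fact_gt0. Qed.

Lemma msymm_diag n (F : multiform V n) x : msymm F (fun=> x) = F (fun=> x).
Proof.
rewrite msymmE; under eq_bigr do rewrite (_ : _ \o _ = fun=> x)//.
by rewrite sumr_const card_Sn fact_mulVn.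
Qed.

Lemma msymm_symmetric n (F : multiform V n) : msymmetric (msymm F).
Proof.
move=> s; apply: multiform_eq => v; rewrite [LHS](msymmE F (v \o s)) msymmE; congr (_ * _).
rewrite (reindex_inj (mulIg s^-1%g)) /=; apply: eq_bigr => s' _; congr (F _).
by apply/funext => i /=; rewrite permM permKV.
Qed.

Lemma msymmetric_polarization n (F : multiform V n) v : msymmetric F ->
  F v = n`!%:R^-1 * \sum_(e : {ffun 'I_n -> bool})
    (\prod_i (-1) ^+ (~~ e i)) * F (fun=> \sum_i (e i)%:R *: v i).
Proof.
move=> Fsym; rewrite polarization -msymmE; suff -> : msymm F = F by [].
apply: multiform_eq => w; rewrite msymmE.
under eq_bigr => s _ do rewrite -[F (w \o s)]/(mperm s F w) Fsym.
by rewrite sumr_const card_Sn fact_mulVn.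
Qed.

(** Polarization turns each elementary tensor into diagonal ones, as far as symmetric forms can
    tell. The list depends on u alone, so it can be used for several forms at once. *)
Lemma tpow_diagonal n (u : tpow V n) : exists r : seq (R * V),
  forall F : multiform V n, msymmetric F -> tfun F u = \sum_(p <- r) p.1 * F (fun=> p.2).
Proof.
have [s us] := tpowP u.
exists [seq (c.1 * n`!%:R^-1 * (\prod_i (-1) ^+ (~~ e i)), \sum_i (e i)%:R *: c.2 i) |
  c <- s, e : {ffun 'I_n -> bool} <- index_enum {ffun 'I_n -> bool}] => F Fsym.
rewrite us big_allpairs_dep; apply: eq_bigr => c _.
rewrite (msymmetric_polarization _ Fsym) mulrA mulr_sumr.
by apply: eq_bigr => e _ /=; rewrite mulrA.
Qed.

Lemma multiform_diff n (F F' : multiform V n) a v : (F - a *: F') v = F v - a * F' v.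
Proof. by []. Qed.

End symmetric_forms.

Section wick_hermite.
Context {R : realType} (G : gelfand_triple R).
Variable A : {linear l2 (gH G) -> l2 (gH G)}.
Implicit Types omega : sNdual G.

Lemma wick_form_symmetric omega n : msymmetric (wick_form A omega n).
Proof.
have mulB N (F F' : multiform (sN G) N) (a : R) :
    msymmetric F -> msymmetric F' -> msymmetric (F - a *: F').
  move=> Fs F's s; rewrite -[in RHS](Fs s) -[in RHS](F's s).
  exact: multiform_eq.
suff [] : msymmetric (wick_pair A omega n).1 /\ msymmetric (wick_pair A omega n).2 by [].
elim: n => [|n [IH1 IH2]]; first by split=> s; apply: multiform_eq => v //=; rewrite /= ord1.
by split=> //; apply: mulB; exact: msymm_symmetric.
Qed.

(** On equal arguments symmetrization does nothing and tensor products become products, so the two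
    recursions agree term by term. *)
Lemma wick_form_diag omega n v :
  wick_form A omega n (fun=> v) =
  hermite (A_inner A (sN_to_l2 v) (sN_to_l2 v)) (omega v) n.
Proof.
rewrite /hermite /wick_form; set c := A_inner _ _ _.
suff [] : (wick_pair A omega n).1 (fun=> v) = (hermite_pair c (omega v) n).1 /\
    (wick_pair A omega n).2 (fun=> v) = (hermite_pair c (omega v) n).2 by [].
elim: n => [//|n [IH1 IH2]]; split; first exact: IH2.
rewrite [LHS](multiform_diff (mtensor_sym (mlin omega) (wick_pair A omega n).2)).
by rewrite !msymm_diag /= -IH1 -IH2.
Qed.

End wick_hermite.

(** * Gaussian families *)

Section L1_convergence.
Context {R : realType} d {T : measurableType d} (mu : probability T R).
Implicit Types (f g X Y : T -> R).

Local Notation L1 f := (mu.-integrable [set: T] (EFin \o f)).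

Lemma cos_lipschitz (u v : R) : `|cos u - cos v| <= `|u - v|.
Proof.
wlog uv : u v / v <= u.
  by move=> h; have [/h//|/ltW/h] := leP v u; rewrite distrC (distrC u).
have [c _ ->] := @MVT_segment _ cos (fun r => - sin r) v u uv
  (fun r _ => is_derive_cos r) (continuous_subspaceT (@continuous_cos R)).
by rewrite normrM normrN ler_piMl// sin_max.
Qed.

(** Hoelder's inequality against the constant 1, whose norm is 1. Convergence in L^1 is all that
    integrals against bounded functions need. *)
Lemma L2_limit_L1 (F : nat -> T -> R) X : (forall k, L1 (F k)) ->
  L2_limit mu F X ->
  L1 X /\ \int[mu]_w `|F k w - X w| @[k --> \oo] --> (0 : R).
Proof.
move=> FL [X2 FX].
have XL : L1 X.
  apply/Lfun1_integrable; apply: Lfun_subset12 X2.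
  by rewrite fin_num_measure.
split=> //.
have DL k : L1 (fun w => F k w - X w) by exact: L1B.
have E k : (\int[mu]_w `|F k w - X w|)%:E = ('N[mu]_1[EFin \o (F k \- X)%R])%E.
  rewrite Lnorm1 /Rintegral fineK//.
  by apply: integrable_fin_num => //; have := integrable_abse (DL k).
have le12 k : ((\int[mu]_w `|F k w - X w|)%:E <= 'N[mu]_2%:E[EFin \o (F k \- X)%R])%E.
  rewrite E.
  have half : (2^-1 + 2^-1 = 1 :> R) by field.
  have := hoelder mu (L1_measurable (DL k)) (measurable_cst (1 : R)) (ltr0n _ 2) (ltr0n _ 2) half.
  rewrite Lnorm_cst1 [X in (_ * (X `^ _))%E](@probability_setT _ _ _ mu) poweR1r mule1.
  by rewrite (_ : (_ \* _)%R = (F k \- X)%R)//; apply/funext => w /=; rewrite mulr1.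
have : (\int[mu]_w `|F k w - X w|)%:E @[k --> \oo] --> (0 : R)%:E.
  apply: (squeeze_cvge _ (cvg_cst 0%E) FX); apply: nearW => k.
  by rewrite le12 andbT lee_fin Rintegral_ge0.
by move/fine_cvg.
Qed.

Lemma Rintegral_mul_cvg (F : nat -> T -> R) X g : (forall k, L1 (F k)) -> L1 X ->
  measurable_fun [set: T] g -> (forall w, `|g w| <= 1) ->
  \int[mu]_w `|F k w - X w| @[k --> \oo] --> (0 : R) ->
  \int[mu]_w (F k w * g w) @[k --> \oo] --> \int[mu]_w (X w * g w).
Proof.
move=> FL XL mg g1 FX.
have Lg f : L1 f -> L1 (fun w => f w * g w) by move=> fL; exact: L1_bounded fL mg g1.
apply/subr_cvg0; apply: norm_cvg0.
apply: (@squeeze_cvgr _ _ _ _ (cst 0) _ _ _ _ _ FX); last exact: cvg_cst.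
apply: nearW => k; rewrite normr_ge0 /= -RintegralB//; [|exact: Lg..].
under eq_Rintegral do rewrite -mulrBl.
apply: le_trans (le_normr_Rintegral measurableT (Lg _ (L1B (FL k) XL))) _.
apply: le_Rintegral => //; [exact/L1_norm/Lg/L1B|exact/L1_norm/L1B|].
by move=> w _; rewrite normrM ler_piMr.
Qed.

End L1_convergence.

Section gaussian_families.
Context {R : realType} d {T : measurableType d} (mu : probability T R).
Context (H : hilbertType R).

Local Notation L1 f := (mu.-integrable [set: T] (EFin \o f)).

Definition rv_comb (I : Type) (X : I -> T -> R) (r : seq (R * I)) (w : T) : R :=
  \sum_(p <- r) p.1 * X p.2 w.

Definition vec_comb (I : Type) (e : I -> H) (r : seq (R * I)) : H :=
  \sum_(p <- r) p.1 *: e p.2.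

(** Centered jointly Gaussian variables with covariances (e_i, e_j). Storing vectors instead of a
    covariance matrix lets limits of variables go along with limits of vectors. *)
Definition gaussian_family (I : Type) (X : I -> T -> R) (e : I -> H) :=
  (forall i, measurable_fun [set: T] (X i)) /\
  forall r t, \int[mu]_w cos (rv_comb X r w + t) =
    cos t * expR (- 2^-1 * inner (vec_comb e r) (vec_comb e r)).

Lemma rv_comb_cat (I : Type) (X : I -> T -> R) r s w :
  rv_comb X (r ++ s) w = rv_comb X r w + rv_comb X s w.
Proof. exact: big_cat. Qed.

Lemma vec_comb_cat (I : Type) (e : I -> H) r s :
  vec_comb e (r ++ s) = vec_comb e r + vec_comb e s.
Proof. exact: big_cat. Qed.

Definition scale_comb (I : Type) (a : R) (r : seq (R * I)) := [seq (a * p.1, p.2) | p <- r].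

Lemma rv_comb_scale (I : Type) (X : I -> T -> R) a r w :
  rv_comb X (scale_comb a r) w = a * rv_comb X r w.
Proof. by rewrite /rv_comb big_map mulr_sumr; apply: eq_bigr => p _; rewrite mulrA. Qed.

Lemma vec_comb_scale (I : Type) (e : I -> H) a r :
  vec_comb e (scale_comb a r) = a *: vec_comb e r.
Proof. by rewrite /vec_comb big_map scaler_sumr; apply: eq_bigr => p _; rewrite scalerA. Qed.

Definition map_comb (I I' : Type) (k : I' -> I) (r : seq (R * I')) := [seq (p.1, k p.2) | p <- r].

Lemma gaussian_family_reindex (I I' : Type) (k : I' -> I) (X : I -> T -> R) (e : I -> H) :
  gaussian_family X e -> gaussian_family (X \o k) (e \o k).
Proof.
move=> [mX gX]; split=> [i|r t]; first exact: mX.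
have := gX (map_comb k r) t.
rewrite (_ : vec_comb e _ = vec_comb (e \o k) r); last by rewrite /vec_comb big_map.
by under eq_Rintegral do rewrite /rv_comb big_map.
Qed.

Section family.
Context (I : Type) (X : I -> T -> R) (e : I -> H) (gX : gaussian_family X e).

Lemma measurable_rv_comb r : measurable_fun [set: T] (rv_comb X r).
Proof. exact: measurable_comb gX.1 r. Qed.

Lemma gaussian_family_pair r s :
  gaussian_pair mu (rv_comb X r) (inner (vec_comb e r) (vec_comb e r))
    (rv_comb X s) (inner (vec_comb e r) (vec_comb e s))
    (inner (vec_comb e s) (vec_comb e s)).
Proof.
move=> a t; have := gX.2 (scale_comb a r ++ s) t.
under eq_Rintegral do rewrite rv_comb_cat rv_comb_scale.
move=> ->; congr (_ * expR (_ * _)).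
rewrite vec_comb_cat vec_comb_scale linearDl /= !linearDr /= !linearZl /= !linearZr /=.
have scaleE (u v : R) : u *: v = u * v by [].
by rewrite !scaleE (innerC (vec_comb e s)); ring.
Qed.

Lemma gaussian_family_moments r i : L1 (fun w => rv_comb X r w ^+ i).
Proof.
apply: (@gaussian_moments _ _ _ _ _ (inner (vec_comb e r) (vec_comb e r))).
- exact: measurable_rv_comb.
- by rewrite inner_norm sqr_ge0.
(* The empty combination is the zero variable that [gaussian_moments] asks for. *)
have := gaussian_family_pair r [::].
have -> : rv_comb X [::] = cst 0 by apply/funext => w; rewrite /rv_comb big_nil.
have -> : vec_comb e [::] = 0 by rewrite /vec_comb big_nil.
by rewrite !linear0r /=.
Qed.

(** This models <u, :.^n:> for u the sum of the a v^(tensor n), where (a, r) runs through [W] and v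
    = [vec_comb e r]. *)
Definition hermite_comb n (W : seq (R * seq (R * I))) w : R :=
  \sum_(p <- W) p.1 * hermite (inner (vec_comb e p.2) (vec_comb e p.2)) (rv_comb X p.2 w) n.

Lemma hermite_rv_comb_L1 n c r : L1 (fun w => hermite c (rv_comb X r w) n).
Proof.
have := @L1_pow_hermite _ _ _ mu _ c n (fun i _ => gaussian_family_moments r i) n 0 (leqnn n).
by under eq_fun do rewrite expr0 mul1r.
Qed.

Lemma hermite_comb_L1 n W : L1 (hermite_comb n W).
Proof. by apply: L1_sum => p; apply: L1Z; exact: hermite_rv_comb_L1. Qed.

(** The sum on the right is the inner product of that tensor u with eta^(tensor n), eta =
    [vec_comb e s]; in this form the identity passes to limits of tensors. *)
Lemma hermite_comb_transform n W s t :
  \int[mu]_w (hermite_comb n W w * cos (rv_comb X s w + t)) =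
  cos (t + n%:R * (pi / 2)) *
  (\sum_(p <- W) p.1 * inner (vec_comb e p.2) (vec_comb e s) ^+ n) *
  expR (- 2^-1 * inner (vec_comb e s) (vec_comb e s)).
Proof.
under eq_Rintegral do rewrite mulr_suml.
under eq_Rintegral do under eq_bigr do rewrite -mulrA.
rewrite Rintegral_sum; last first.
  move=> p; apply: L1_cos; first exact: hermite_rv_comb_L1.
  by apply: measurable_funD => //; exact: measurable_rv_comb.
rewrite mulr_sumr mulr_suml; apply: eq_bigr => p _.
rewrite (@hermite_transform _ _ _ mu _ _ n (measurable_rv_comb p.2) _ _ _ _ _ t (leqnn n)
  (measurable_rv_comb s) (gaussian_family_pair p.2 s)); first ring.
by move=> i _; exact: gaussian_family_moments.
Qed.

End family.

(** The cosine is 1-Lipschitz, so its integrals converge along with the variables in L^1, while the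
    Gaussian side is continuous in the vectors. It brings in the <psi_k, .>, which exist only as
    limits. *)
Lemma gaussian_family_limit (I : Type) (X_ : nat -> I -> T -> R) (e_ : nat -> I -> H)
    (X : I -> T -> R) (e : I -> H) :
  (forall k, gaussian_family (X_ k) (e_ k)) -> (forall i, L1 (X i)) ->
  (forall i, e_ k i @[k --> \oo] --> e i) ->
  (forall i, \int[mu]_w `|X_ k i w - X i w| @[k --> \oo] --> (0 : R)) ->
  gaussian_family X e.
Proof.
move=> gX XL ee XX.
have mX i : measurable_fun [set: T] (X i) by exact: L1_measurable (XL i).
have X_L k i : L1 (X_ k i).
  have := gaussian_family_moments (gX k) [:: (1, i)] 1.
  by under eq_fun do rewrite expr1 /rv_comb big_seq1 mul1r.
split=> // r t.
have vcvg : vec_comb (e_ k) r @[k --> \oo] --> vec_comb e r.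
  rewrite /vec_comb; elim: r => [|p r IHr].
    by under eq_fun do rewrite big_nil; rewrite big_nil; exact: cvg_cst.
  under eq_fun do rewrite big_cons; rewrite big_cons.
  by apply: cvgD IHr; apply: cvgZr; exact: ee.
have rcvg : \int[mu]_w `|rv_comb (X_ k) r w - rv_comb X r w| @[k --> \oo] --> (0 : R).
  have DL k i : L1 (fun w => X_ k i w - X i w) by exact: L1B.
  have combB k s w : rv_comb (X_ k) s w - rv_comb X s w =
      \sum_(p <- s) p.1 * (X_ k p.2 w - X p.2 w).
    by rewrite /rv_comb -sumrB; apply: eq_bigr => p _; rewrite mulrBr.
  have bound k : \int[mu]_w `|rv_comb (X_ k) r w - rv_comb X r w| <=
      \sum_(p <- r) `|p.1| * \int[mu]_w `|X_ k p.2 w - X p.2 w|.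
    rewrite -Rintegral_sum; last by move=> p; exact: L1_norm.
    apply: le_Rintegral => //.
    - under eq_fun do rewrite combB.
      by apply/L1_norm/L1_sum => p; exact: L1Z.
    - by apply: L1_sum => p; exact/L1Z/L1_norm.
    move=> w _; rewrite combB; apply: le_trans (ler_norm_sum _ _ _) _.
    by rewrite le_eqVlt; apply/orP; left; apply/eqP; apply: eq_bigr => p _; rewrite normrM.
  apply: (@squeeze_cvgr _ _ _ _ (cst 0)
    (fun k => \sum_(p <- r) `|p.1| * \int[mu]_w `|X_ k p.2 w - X p.2 w|)).
  - by apply: nearW => k; rewrite bound andbT Rintegral_ge0.
  - exact: cvg_cst.
  elim: r {bound vcvg} => [|p r IHr].
    by under eq_fun do rewrite big_nil; exact: cvg_cst.
  under eq_fun do rewrite big_cons.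
  have h : `|p.1| * \int[mu]_w `|X_ k p.2 w - X p.2 w| @[k --> \oo] --> `|p.1| * 0.
    by apply: cvgMr; exact: XX.
  have : `|p.1| * \int[mu]_w `|X_ k p.2 w - X p.2 w| +
      \sum_(q <- r) `|q.1| * \int[mu]_w `|X_ k q.2 w - X q.2 w| @[k --> \oo] -->
      `|p.1| * 0 + 0 by exact: cvgD.
  by rewrite mulr0 addr0.
have ecvg : cos t * expR (- 2^-1 * inner (vec_comb (e_ k) r) (vec_comb (e_ k) r)) @[k --> \oo] -->
   cos t * expR (- 2^-1 * inner (vec_comb e r) (vec_comb e r)).
  apply: cvgMr; apply: continuous_cvg; first exact: continuous_expR.
  apply: cvgMr; rewrite inner_norm; under eq_fun do rewrite inner_norm.
  by rewrite expr2; under eq_fun do rewrite expr2; apply: cvgM; exact: cvg_norm.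
have ccvg : \int[mu]_w cos (rv_comb (X_ k) r w + t) @[k --> \oo] -->
    \int[mu]_w cos (rv_comb X r w + t).
  have mcomb k : measurable_fun [set: T] (rv_comb (X_ k) r) := measurable_rv_comb (gX k) r.
  have mX' : measurable_fun [set: T] (rv_comb X r) := measurable_comb mX r.
  have cosL (f : T -> R) : measurable_fun [set: T] f -> L1 (fun w => cos (f w + t)).
    move=> mf; have := L1_cos (L1_cst mu 1) (measurable_funD mf (measurable_cst t)).
    by under eq_fun do rewrite mul1r.
  have combL Z : (forall i, L1 (Z i)) -> L1 (rv_comb Z r).
    by move=> ZL; apply: L1_sum => p; exact: L1Z.
  apply/subr_cvg0; apply: norm_cvg0.
  apply: (@squeeze_cvgr _ _ _ _ (cst 0) _ _ _ _ _ rcvg); last exact: cvg_cst.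
  apply: nearW => k; rewrite normr_ge0 /= -RintegralB//; [|exact: cosL..].
  apply: le_trans (le_normr_Rintegral measurableT (L1B (cosL _ (mcomb k)) (cosL _ mX'))) _.
  apply: le_Rintegral => //.
  - exact/L1_norm/(L1B (cosL _ (mcomb k)) (cosL _ mX')).
  - by apply/L1_norm/L1B; exact: combL.
  move=> w _; apply: le_trans (cos_lipschitz _ _) _.
  by rewrite opprD addrACA subrr addr0.
move: ccvg; under eq_fun do rewrite (gX _).2.
by move=> ccvg; exact: (cvg_unique _ ccvg ecvg).
Qed.

End gaussian_families.

(** * Tensor powers and the projection *)

Section hilbert_tensor_facts.
Context {R : realType}.

Lemma continuous_inner (V : hilbertType R) (a : V) : continuous (fun x : V => inner x a : R).
Proof.
move=> x; rewrite /continuous_at.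
rewrite (_ : (fun x => _) =
    fun x => 2^-1 * (`|x + a| * `|x + a| - `|x| * `|x| - `|a| * `|a|)); last first.
  by apply/funext => y; rewrite inner_polar !expr2.
have Cadd : (x0 + a) @[x0 --> x] --> x + a by apply: cvgD; [exact: cvg_id|exact: cvg_cst].
have Cid : x0 @[x0 --> x] --> x by exact: cvg_id.
rewrite inner_polar !expr2.
apply: cvgMr; apply: cvgB; last exact: cvg_cst.
apply: cvgB; first by apply: cvgM; exact: cvg_norm.
by apply: cvgM; exact: cvg_norm.
Qed.

Lemma dense_continuous_eq0 (V : hilbertType R) (h : V -> R) (S : set V) :
  continuous h -> dense S -> (forall x, S x -> h x = 0) -> forall x, h x = 0.
Proof.
move=> hcont Sdense hS x; apply: contrapT => hx.
have O_open : open (h @^-1` [set r | r != 0]).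
  by apply: open_comp => [y _|]; [exact: hcont|exact: open_neq].
have [|y [/= /eqP hy /hS]//] := Sdense _ _ O_open.
by exists x; exact/eqP.
Qed.

Lemma innerDl (V : hilbertType R) (x y z : V) : inner (x + y) z = inner x z + inner y z.
Proof. exact: linearDl. Qed.

Lemma innerZl (V : hilbertType R) a (x z : V) : inner (a *: x) z = a * inner x z.
Proof. exact: linearZl_LR. Qed.

Lemma inner_suml (V : hilbertType R) (I : Type) (r : seq I) (c : I -> R) (x : I -> V) z :
  inner (\sum_(i <- r) c i *: x i) z = \sum_(i <- r) c i * inner (x i) z.
Proof.
elim: r => [|i r IHr]; first by rewrite !big_nil linear0l.
by rewrite !big_cons innerDl innerZl IHr.
Qed.

Lemma orth_proj_selfadjoint (V : hilbertType R) m (psi : 'I_m -> V) x y :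
  inner (orth_proj psi x) y = inner x (orth_proj psi y).
Proof.
rewrite (innerC x) !inner_suml; apply: eq_bigr => k _.
by rewrite mulrC (innerC y) (innerC x).
Qed.

Lemma orth_proj_comb (V : hilbertType R) m (psi : 'I_m -> V) (r : seq (R * 'I_m)) :
  orthonormal_family psi -> orth_proj psi (vec_comb psi r) = vec_comb psi r.
Proof.
move=> psi_on; have proj_linear : linear (orth_proj psi).
  move=> a x y; rewrite /orth_proj scaler_sumr -big_split; apply: eq_bigr => k _ /=.
  by rewrite innerDl innerZl scalerDl scalerA.
rewrite (linear_combination proj_linear); apply: eq_bigr => p _; congr (_ *: _).
rewrite /orth_proj (bigD1 p.2)//= psi_on eqxx scale1r big1 ?addr0// => j jp.
by rewrite psi_on eq_sym (negbTE jp) scale0r.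
Qed.

Section tensor_power.
Context (V W : hilbertType R) (n : nat) (t : ('I_n -> V) -> W).
Hypothesis t_tensor : is_hilbert_tensor_power t.

(** On elementary tensors this is the symmetry of P in each factor; both sides are continuous in f,
    and the span of these tensors is dense. *)
Lemma inner_tensor_op (P : V -> V) (Pn : W -> W) f z :
  (forall x y, inner (P x) y = inner x (P y)) -> is_tensor_power_op t P Pn ->
  inner (Pn f) (t (fun=> z)) = inner f (t (fun=> P z)).
Proof.
move=> Psym [Pn_lin Pn_cont PnE]; have [t_mult t_inner t_dense] := t_tensor.
apply/eqP; rewrite -subr_eq0; apply/eqP; move: f.
apply: (dense_continuous_eq0 _ t_dense).
  move=> x; apply: cvgB; last exact: continuous_inner.
  apply: (@continuous_comp _ _ _ Pn (fun y => inner y (t (fun=> z)))).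
    exact: Pn_cont.
  exact: continuous_inner.
move=> _ [k [c [v [vE ->]]]].
rewrite (linear_combination Pn_lin) !inner_suml -sumrB big1// => i _.
have [u _ <-] := vE i.
by rewrite PnE !t_inner (eq_bigr _ (fun j _ => Psym _ _)) subrr.
Qed.

Lemma inner_tensor_comb m (c : 'I_m -> R) (w : 'I_m -> V) f :
  inner f (t (fun=> \sum_k c k *: w k)) =
  \sum_(g : {ffun 'I_n -> 'I_m}) inner f (t (w \o g)) * \prod_j c (g j).
Proof.
have [t_mult _ _] := t_tensor.
rewrite (multilinear_expand (fun=> c) w t_mult) innerC inner_suml.
by apply: eq_bigr => g _; rewrite mulrC innerC.
Qed.

End tensor_power.
End hilbert_tensor_facts.

(** * Fourier transforms of Wick powers *)

Section white_noise.
Context {R : realType} (G : gelfand_triple R).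
Variable A : {linear l2 (gH G) -> l2 (gH G)}.
Variable mu : probability (sNdual G) R.
Hypothesis mu_A : gaussian_measure A mu.
Context (LA : hilbertType R) (J : l2 (gH G) -> LA).
Hypothesis LA_completion : is_completion (A_inner A) J.

Local Notation L1 f := (mu.-integrable [set: sNdual G] (EFin \o f)).

Definition sN_eval (phi : sN G) (omega : sNdual G) : R := omega phi.
Definition sN_vec (phi : sN G) : LA := J (sN_to_l2 phi).

Lemma sN_vec_linear : linear sN_vec.
Proof.
have [Jlin _ _] := LA_completion; move=> a f g; rewrite -Jlin; congr J.
exact/val_inj.
Qed.

Lemma measurable_sN_eval phi : measurable_fun [set: sNdual G] (sN_eval phi).
Proof.
move=> _ B mB; apply: sub_sigma_algebra; exists phi => //.
by exists B.
Qed.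

Lemma gaussian_family_sN : gaussian_family mu sN_eval sN_vec.
Proof.
have [_ Jinner _] := LA_completion.
split=> [|r t]; first exact: measurable_sN_eval.
pose phi := \sum_(p <- r) p.1 *: p.2.
have -> : vec_comb sN_vec r = sN_vec phi.
  by rewrite /phi (linear_combination sN_vec_linear).
rewrite Jinner; have [<- sin0] := mu_A phi.
have E omega : rv_comb sN_eval r omega = omega phi.
  by rewrite /rv_comb linear_sum; apply: eq_bigr => p _; rewrite linearZ.
have mphi := measurable_sN_eval phi.
have one_L1 := L1_cst mu 1.
have cosL : L1 (fun omega : sNdual G => cos (omega phi)).
  by have := L1_cos one_L1 mphi; under eq_fun do rewrite mul1r.
have sinL : L1 (fun omega : sNdual G => sin (omega phi)).
  have := L1_bounded one_L1 (measurable_sin_comp mphi) (fun w => sin_max _).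
  by under eq_fun do rewrite mul1r.
transitivity (\int[mu]_omega (cos t * cos (omega phi : R) - sin t * sin (omega phi : R))).
  by apply: eq_Rintegral => omega _; rewrite E cosD mulrC [sin _ * _]mulrC.
by rewrite RintegralB//; [rewrite !RintegralZl// sin0 mulr0 subr0|exact: L1Z..].
Qed.

Section tensor_transform.
Context (n : nat) (LAn : hilbertType R) (t : ('I_n -> LA) -> LAn).
Hypothesis t_tensor : is_hilbert_tensor_power t.

Lemma sN_tensor_multilinear : multilinear (fun v : 'I_n -> sN G => t (fun i => sN_vec (v i))).
Proof.
have [t_mult _ _] := t_tensor; move=> i v a x y.
have E z : (fun j => sN_vec (if j == i then z else v j)) =
    fun j => if j == i then sN_vec z else sN_vec (v j).
  by apply/funext => j; case: ifP.
by rewrite !E sN_vec_linear t_mult.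
Qed.

(** The Wick power and the inner product with z^(tensor n) both evaluate a symmetric form at u, so a
    single diagonal list links the random variable to its tensor. *)
Lemma wick_diagonal (u : tpow (sN G) n) : exists r : seq (R * sN G),
  (forall omega, wick A u omega =
    \sum_(p <- r) p.1 * hermite (inner (sN_vec p.2) (sN_vec p.2)) (omega p.2) n) /\
  (forall z, inner (sN_tensor J t u) (t (fun=> z)) =
    \sum_(p <- r) p.1 * inner (sN_vec p.2) z ^+ n).
Proof.
have [_ t_inner _] := t_tensor; have [_ Jinner _] := LA_completion.
have [r ur] := tpow_diagonal u; exists r; split=> [omega|z].
  rewrite /wick ur; last exact: wick_form_symmetric.
  by apply: eq_bigr => p _; rewrite wick_form_diag Jinner.
rewrite innerC (inner_tmap sN_tensor_multilinear) ur.
  apply: eq_bigr => p _; rewrite /= t_inner prodr_const card_ord.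
  by rewrite innerC.
move=> s; apply: multiform_eq => v /=; rewrite !t_inner.
by rewrite [RHS](reindex_inj (@perm_inj _ s)).
Qed.

(** Both sides pass to the limit along the approximating tensors. The family may extend that of the
    test functionals, so that s may also involve limits such as [xi]. *)
Lemma wick_transform (I : Type) (X : I -> sNdual G -> R) (e : I -> LA) (k : sN G -> I)
    (f : LAn) (Xf : sNdual G -> R) :
  gaussian_family mu X e -> (forall phi, X (k phi) = sN_eval phi) ->
  (forall phi, e (k phi) = sN_vec phi) -> is_wick A mu J t f Xf ->
  L1 Xf /\ forall s b,
  \int[mu]_omega (Xf omega * cos (rv_comb X s omega + b)) =
  cos (b + n%:R * (pi / 2)) * inner f (t (fun=> vec_comb e s)) *
  expR (- 2^-1 * inner (vec_comb e s) (vec_comb e s)).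
Proof.
move=> gX Xk ek [u [_ uf uX]].
have /choice[W WE] : forall j, exists W : seq (R * seq (R * I)),
    wick A (u j) = hermite_comb X e n W /\
    forall z, inner (sN_tensor J t (u j)) (t (fun=> z)) =
      \sum_(p <- W) p.1 * inner (vec_comb e p.2) z ^+ n.
  move=> j; have [r [r1 r2]] := wick_diagonal (u j).
  exists [seq (p.1, [:: (1, k p.2)]) | p <- r]; split.
    apply/funext => omega; rewrite r1 /hermite_comb big_map; apply: eq_bigr => p _.
    by rewrite /= /vec_comb /rv_comb !big_seq1 /= mul1r scale1r Xk ek.
  move=> z; rewrite r2 big_map; apply: eq_bigr => p _.
  by rewrite /= /vec_comb big_seq1 /= scale1r ek.
have WL j : L1 (wick A (u j)) by rewrite (WE j).1; exact: hermite_comb_L1.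
have [XL Xcvg] := L2_limit_L1 WL uX.
split=> // s b.
have mc : measurable_fun [set: sNdual G] (fun omega => cos (rv_comb X s omega + b)).
  by apply: measurable_cos_comp; apply: measurable_funD => //; exact: measurable_rv_comb gX s.
have lim1 := Rintegral_mul_cvg WL XL mc (fun w => cos_max _) Xcvg.
set a := t (fun=> vec_comb e s).
have lim2 : cos (b + n%:R * (pi / 2)) * inner (sN_tensor J t (u j)) a *
    expR (- 2^-1 * inner (vec_comb e s) (vec_comb e s)) @[j --> \oo] -->
   cos (b + n%:R * (pi / 2)) * inner f a * expR (- 2^-1 * inner (vec_comb e s) (vec_comb e s)).
  apply: cvgMl; apply: cvgMr.
  exact: (cvg_comp _ _ uf (@continuous_inner _ _ a f)).
move: lim1; under eq_fun do rewrite (WE _).1 (hermite_comb_transform gX) -(WE _).2.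
by move=> lim1; exact: (cvg_unique _ lim1 lim2).
Qed.

End tensor_transform.
End white_noise.

Section projected_tensors.
Context {R : realType} (V W : hilbertType R) (n m : nat) (t : ('I_n -> V) -> W).
Hypothesis t_tensor : is_hilbert_tensor_power t.

(** Expanding P z leaves products of the (z, psi_(g j)), one for each g, with coefficients (f,
    psi_(g 1) tensor ...). Polarization rewrites such a product through n-th powers of (z, sum of
    some psi_(g j)), with a list that does not depend on z. *)
Lemma orth_proj_polarization (psi : 'I_m -> V) (f : W) :
  exists r : seq (R * seq (R * 'I_m)), forall z,
    \sum_(p <- r) p.1 * inner (vec_comb psi p.2) z ^+ n =
    inner f (t (fun=> orth_proj psi z)).
Proof.
have [t_mult t_inner _] := t_tensor.
exists [seq (inner f (t (psi \o g)) * (n`!%:R^-1 * \prod_i (-1) ^+ (~~ e i)),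
    [seq ((e i)%:R, g i) | i <- index_enum 'I_n]) |
  g : {ffun 'I_n -> 'I_m} <- index_enum {ffun 'I_n -> 'I_m},
  e : {ffun 'I_n -> bool} <- index_enum {ffun 'I_n -> bool}] => z.
rewrite big_allpairs_dep (inner_tensor_comb t_tensor); apply: eq_bigr => g _ /=.
pose F := Multiform (inner_multilinear t_mult (t (fun=> z))).
have Fsym : msymmetric F.
  move=> s; apply: multiform_eq => v /=; rewrite !t_inner.
  by rewrite [RHS](reindex_inj (@perm_inj _ s)).
have FE v : F v = \prod_j inner z (v j) by rewrite /F /= t_inner.
have := msymmetric_polarization (psi \o g) Fsym; rewrite FE => ->.
rewrite !mulr_sumr; apply: eq_bigr => e _; rewrite -!mulrA; congr (_ * (_ * (_ * _))).
by rewrite FE prodr_const card_ord innerC /vec_comb big_map.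
Qed.

End projected_tensors.

Lemma hermite_comb_g_sigma (R : realType) d (T : measurableType d) n m (xi : 'I_m -> T -> R)
    (c : seq (R * 'I_m) -> R) (r : seq (R * seq (R * 'I_m)))
    (B : set R) : measurable B ->
  g_sigma_preimage xi
    ((fun w => \sum_(p <- r) p.1 * hermite (c p.2) (rv_comb xi p.2 w) n) @^-1` B).
Proof.
move=> mB.
(* [T'] is T with the sigma-algebra generated by the [xi], so that the usual closure properties of
   measurable functions apply. *)
pose T' := g_sigma_algebraType
  (\big[setU/set0]_(i < m) preimage_set_system setT (xi i) measurable).
have mxi i : measurable_fun [set: T'] (xi i : T' -> R).
  move=> _ C mC; apply: sub_sigma_algebra; rewrite (bigD1 i)//=; left.
  by exists C.
have mcomb s : measurable_fun [set: T'] (rv_comb xi s : T' -> R).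
  by apply: measurable_sum => p; exact: measurable_funM.
have mherm a s : measurable_fun [set: T'] (fun w : T' => hermite a (rv_comb xi s w) n).
  suff [] : measurable_fun [set: T'] (fun w : T' => hermite a (rv_comb xi s w) n) /\
    measurable_fun [set: T'] (fun w : T' => hermite a (rv_comb xi s w) n.+1) by [].
  elim: n => [|k [IH1 IH2]]; first by split; [exact: measurable_cst|exact: mcomb].
  split; first exact: IH2.
  rewrite (_ : (fun w => _) = fun w => rv_comb xi s w * hermite a (rv_comb xi s w) k.+1 -
      k.+1%:R * (a * hermite a (rv_comb xi s w) k)); last exact/funext.
  apply: measurable_funB; first exact: measurable_funM.
  by apply: measurable_funM => //; exact: measurable_funM.
have : measurable_fun [set: T']
    (fun w : T' => \sum_(p <- r) p.1 * hermite (c p.2) (rv_comb xi p.2 w) n).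
  by apply: measurable_sum => p; exact: measurable_funM.
by move=> /(_ measurableT B mB); rewrite setTI.
Qed.

(** * The conditional expectation *)

Theorem theorem3p9 (R : realType) (G : gelfand_triple R)
  (H_separable : separable_space (gH G))
  (H_infinite : infinite_dimensional (gH G))
  (A : {linear l2 (gH G) -> l2 (gH G)})
  (A_bounded : bounded_op A)
  (A_selfadjoint : selfadjoint_op A)
  (A_posdef : posdef_op A)
  (mu : probability (sNdual G) R)
  (mu_A : gaussian_measure A mu)
  (LA : hilbertType R) (J : l2 (gH G) -> LA)
  (LA_completion : is_completion (A_inner A) J)
  (n m : nat) (m_gt0 : (0 < m)%N)
  (LAn : hilbertType R) (t : ('I_n -> LA) -> LAn)
  (LAn_tensor : is_hilbert_tensor_power t)
  (f : LAn) (f_sym : symmetric_tensors t f)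
  (psi : 'I_m -> LA) (psi_orthonormal : orthonormal_family psi)
  (Ppsin : LAn -> LAn)
  (Ppsin_tensor : is_tensor_power_op t (orth_proj psi) Ppsin)
  (xi : 'I_m -> sNdual G -> R)
  (xi_pairing : forall k, is_pairing mu J (psi k) (xi k))
  (X Y : sNdual G -> R)
  (X_wick : is_wick A mu J t f X)
  (Y_wick : is_wick A mu J t (Ppsin f) Y) :
  is_cond_expectation mu (g_sigma_preimage xi) X Y.
Proof.
pose X_ (i : 'I_m + sN G) := match i with inl k => xi k | inr phi => sN_eval phi end.
pose e_ (i : 'I_m + sN G) := match i with inl k => psi k | inr phi => sN_vec J phi end.
have base := gaussian_family_sN mu_A LA_completion.
have eval_L1 phi : mu.-integrable setT (EFin \o sN_eval phi).
  have := gaussian_family_moments base [:: (1, phi)] 1.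
  by under eq_fun do rewrite expr1 /rv_comb big_seq1 mul1r.
have gX : gaussian_family mu X_ e_.
  pose phi k := projT1 (cid (xi_pairing k)).
  have phi_cvg k : J (sN_to_l2 (phi k j)) @[j --> \oo] --> psi k.
    by rewrite /phi; case: cid => ? [].
  have phi_L1 k := L2_limit_L1 (fun j => eval_L1 (phi k j))
    (projT2 (cid (xi_pairing k))).2.
  (* At stage j each [xi k] is replaced by its j-th approximating test functional; this family is a
     mere reindexing of the test functionals. *)
  pose kappa j (i : 'I_m + sN G) := match i with inl k => phi k j | inr phi => phi end.
  refine (@gaussian_family_limit _ _ _ mu LA _ (fun j => @sN_eval R G \o kappa j)
    (fun j => sN_vec J \o kappa j) X_ e_ _ _ _ _).
  - by move=> j; exact: gaussian_family_reindex.
  - by move=> [k|v]; [exact: (phi_L1 k).1|exact: eval_L1].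
  - by move=> [k|v] /=; [exact: phi_cvg|exact: cvg_cst].
  - move=> [k|v]; first exact: (phi_L1 k).2.
    rewrite /=; under eq_Rintegral do rewrite subrr normr0.
    by rewrite expectation_cst; exact: cvg_cst.
have [XL X_transform] := wick_transform LA_completion LAn_tensor gX
  (k := inr) (fun=> erefl) (fun=> erefl) X_wick.
have [YL Y_transform] := wick_transform LA_completion LAn_tensor gX
  (k := inr) (fun=> erefl) (fun=> erefl) Y_wick.
have [r rE] := orth_proj_polarization LAn_tensor psi f.
pose Z := hermite_comb xi psi n r.
(* The same combinations, with their indices moved into the joint family. *)
pose r' := [seq (p.1, map_comb (inl : 'I_m -> 'I_m + sN G) p.2) | p <- r].
have rv_inl s omega : rv_comb X_ (map_comb inl s) omega = rv_comb xi s omega.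
  by rewrite /rv_comb big_map.
have vec_inl s : vec_comb e_ (map_comb inl s) = vec_comb psi s.
  by rewrite /vec_comb big_map.
have ZE : Z = hermite_comb X_ e_ n r'.
  apply/funext => omega; rewrite /Z /hermite_comb big_map.
  by apply: eq_bigr => p _; rewrite rv_inl vec_inl.
have ZL : mu.-integrable setT (EFin \o Z) by rewrite ZE; exact: hermite_comb_L1.
have proj_inner z : inner (Ppsin f) (t (fun=> z)) = inner f (t (fun=> orth_proj psi z)).
  by apply: inner_tensor_op Ppsin_tensor => //; exact: orth_proj_selfadjoint.
have Z_transform s b : \int[mu]_omega (Z omega * cos (rv_comb X_ s omega + b)) =
    cos (b + n%:R * (pi / 2)) * inner (Ppsin f) (t (fun=> vec_comb e_ s)) *
    expR (- 2^-1 * inner (vec_comb e_ s) (vec_comb e_ s)).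
  rewrite ZE hermite_comb_transform// big_map proj_inner -rE.
  by congr (_ * _ * _); apply: eq_bigr => p _; rewrite vec_inl.
have subZ U : mu.-integrable setT (EFin \o U) ->
    forall s b, \int[mu]_omega ((Z omega - U omega) * cos (rv_comb X_ s omega + b)) =
    \int[mu]_omega (Z omega * cos (rv_comb X_ s omega + b)) -
    \int[mu]_omega (U omega * cos (rv_comb X_ s omega + b)).
  move=> UL s b; under eq_Rintegral do rewrite mulrBl.
  have mc : measurable_fun setT (fun omega => rv_comb X_ s omega + b).
    by apply: measurable_funD => //; exact: measurable_rv_comb gX s.
  by rewrite RintegralB//; exact: L1_cos.
have subI U (UL : mu.-integrable setT (EFin \o U)) C : measurable C ->
    \int[mu]_(omega in C) (Z omega - U omega) = 0 ->
    \int[mu]_(omega in C) Z omega = \int[mu]_(omega in C) U omega.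
  move=> mC; rewrite RintegralB//; [by move/subr0_eq| |].
    by apply: integrableS ZL.
  by apply: integrableS UL.
exists Z; split.
- have [||N [mN N0 ZYN]] := @integral_ae_eq _ _ _ mu setT measurableT (EFin \o Y) (EFin \o Z) ZL.
  + by case/integrableP: YL.
  + move=> C _ mC.
    (* The sigma-algebra of the dual is generated by the evaluations, which belong to the family;
       equal integrals over all its sets give equality almost everywhere. *)
    have CX : <<s cylinder X_ >> C.
      move: C mC; apply: smallest_sub; first exact: smallest_sigma_algebra.
      move=> _ [phi _ [B mB <-]]; apply: sub_sigma_algebra.
      have := cylinderI (inr phi) mB (cylinderT X_).
      by rewrite setIT setTI.
    have ZY0 s b : \int[mu]_omega ((Z omega - Y omega) * cos (rv_comb X_ s omega + b)) = 0.
      by rewrite subZ// Z_transform Y_transform subrr.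
    have := subI _ YL _ mC (fourier_uniqueness gX.1 (L1B ZL YL) ZY0 CX).
    rewrite /Rintegral => /eqP; rewrite -eqe !fineK; last 2 first.
    * by apply: integrable_fin_num => //; exact: integrableS YL.
    * by apply: integrable_fin_num => //; exact: integrableS ZL.
    by move=> /eqP.
  exists N; split=> // omega h; apply: ZYN => /= h'; apply: h => _.
  by have [] := h' I.
- move=> B mB.
  exact: (@hermite_comb_g_sigma R _ (sNdual G) n m xi
    (fun s => inner (vec_comb psi s) (vec_comb psi s)) r B mB).
- exact: ZL.
move=> C GC.
have xi_meas k : measurable_fun setT (xi k) := gX.1 (inl k).
have Cxi : <<s cylinder xi >> C.
  move: C GC; apply: smallest_sub; first exact: smallest_sigma_algebra.
  apply: (big_ind (fun S => S `<=` <<s cylinder xi >>)) => [//|S1 S2 ? ?|k _ _ [B mB <-]].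
    by rewrite subUset.
  apply: sub_sigma_algebra.
  have := cylinderI k mB (cylinderT xi).
  by rewrite setIT setTI.
have mC : measurable C.
  move: C Cxi {GC}; apply: smallest_sub; first exact: sigma_algebra_measurable.
  exact: cylinder_measurable.
apply: subI => //; apply: (fourier_uniqueness xi_meas (L1B ZL XL) _ Cxi) => s b.
(* Only combinations of the [xi] are tested here; their vectors lie in the span of psi, which the
   projection fixes. *)
have := subZ _ XL (map_comb inl s) b.
rewrite Z_transform X_transform proj_inner vec_inl.
under eq_Rintegral do rewrite rv_inl.
move=> ->.
by rewrite orth_proj_comb// subrr.
Qed.
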